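(* Let $d\geq1$ be an integer. The function $(r,a,\alpha,\beta,\gamma)\mapsto g_d(r;a,\alpha,\beta,\gamma)$ from $[0,+\infty[\,\times\,]0,+\infty[\,\times\,\mathcal P_d$ to $\mathbb{R}$ is - continuous with respect to $r$ on $[0,+\infty[$ and infinitely differentiable with respect to $r$ on $]0,a[$ and on $]a,+\infty[$; - continuous and infinitely differentiable with respect to $a$ on $]0,r[$ and on $]r,+\infty[$; - continuous and infinitely differentiable with respect to $\alpha$, $\beta$ and $\gamma$.
   Context: $\mathcal P_d$ is the set of triplets $(\alpha,\beta,\gamma)$ of positive reals with $\alpha>\frac d2$, $2(\beta-\alpha)(\gamma-\alpha)\geq\alpha$ and $2(\beta+\gamma)\geq6\alpha+1$ (these imply $\beta>\alpha$, $\gamma>\alpha$). The radial part of the Gauss hypergeometric covariance is, for $r\geq0$, $a>0$, $(\alpha,\beta,\gamma)\in\mathcal P_d$, $$g_d(r;a,\alpha,\beta,\gamma)=\frac{\Gamma(\beta-\frac d2)\Gamma(\gamma-\frac d2)}{\Gamma(\beta-\alpha+\gamma-\frac d2)\Gamma(\alpha-\frac d2)}\left(1-\frac{r^2}{a^2}\right)_+^{\beta-\alpha+\gamma-\frac d2-1}{}_2F_1\left(\beta-\alpha,\gamma-\alpha;\beta-\alpha+\gamma-\tfrac d2;\left(1-\tfrac{r^2}{a^2}\right)_+\right),$$ where $(x)_+=\max\{x,0\}$ and ${}_2F_1$ is the Gauss hypergeometric function (at argument $1$ it is given by its convergent series). *)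

(* Defs.v *)
From mathcomp Require Export all_boot all_order all_algebra.
From mathcomp Require Export all_classical all_reals all_analysis.
Set Implicit Arguments.
Unset Strict Implicit.
Unset Printing Implicit Defensive.
Export Order.TTheory GRing.Theory Num.Theory.
Export numFieldNormedType.Exports.

Local Open Scope classical_set_scope.
Local Open Scope ring_scope.

(* Euler's integral; it is the Gamma function for [0 < x] only, and carries no
   meaning elsewhere. *)
Definition Gamma (R : realType) (x : R) : R :=
  \int[@lebesgue_measure R]_(t in `]0, +oo[%classic)
    (t `^ (x - 1) * expR (- t)).

(* Rising factorial x (x + 1) ... (x + n - 1). *)
Definition pochhammer (R : realType) (x : R) (n : nat) : R :=
  \prod_(i < n) (x + i%:R).

(* 2F1(a, b; c; x) as the sum of its power series; meaningful for [c] outside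
   0, -1, -2, ... and either [`|x| < 1], or [x = 1] and [0 < c - a - b]. *)
Definition hyp2F1 (R : realType) (a b c x : R) : R :=
  limn (series (fun n : nat =>
    pochhammer a n * pochhammer b n / (pochhammer c n * n`!%:R) * x ^+ n)).

Definition paramP (R : realType) (d : nat) (alpha beta gamma : R) : Prop :=
  [/\ [/\ 0 < alpha, 0 < beta & 0 < gamma],
      d%:R / 2 < alpha,
      alpha <= 2 * (beta - alpha) * (gamma - alpha) &
      6 * alpha + 1 <= 2 * (beta + gamma)].

Definition paramP_set (R : realType) (d : nat) : set 'rV[R]_3 :=
  [set t | paramP d (t 0 0) (t 0 1) (t 0 2)].

(* The exponent of the positive part is positive on [paramP], so that, with
   [powR] satisfying [0 `^ x = 0] for [x != 0], the value for [a <= r] is 0. *)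
Definition gauss_cov (R : realType) (d : nat) (r a alpha beta gamma : R) : R :=
  let h : R := d%:R / 2 in
  let x : R := Num.max (1 - r ^+ 2 / a ^+ 2) 0 in
  Gamma (beta - h) * Gamma (gamma - h)
    / (Gamma (beta - alpha + gamma - h) * Gamma (alpha - h))
  * x `^ (beta - alpha + gamma - h - 1)
  * hyp2F1 (beta - alpha) (gamma - alpha) (beta - alpha + gamma - h) x.

Definition smooth_itv (R : realType) (I : interval R) (f : R -> R) : Prop :=
  forall n : nat, {in I, forall x, derivable (derive1n n f) x 1}.

Definition partial (R : realType) (n : nat) (i : 'I_n.+1)
    (f : 'rV[R]_n.+1 -> R) : 'rV[R]_n.+1 -> R :=
  fun x => 'D_(delta_mx 0 i) f x.

(* On an open set [U]: the partial derivatives of all orders, mixed ones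
   included and in every order of differentiation, exist and are continuous. *)
Definition smooth_open (R : realType) (n : nat) (U : set 'rV[R]_n.+1)
    (f : 'rV[R]_n.+1 -> R) : Prop :=
  forall (s : seq 'I_n.+1) (x : 'rV[R]_n.+1), U x ->
    {for x, continuous (foldr (@partial R n) f s)} /\
    forall i : 'I_n.+1, derivable (foldr (@partial R n) f s) x (delta_mx 0 i).

(* Infinite differentiability on a set [A] that need not be open ([paramP_set]
   is not): [f] is on [A] the restriction of a smooth function on an open
   neighbourhood of [A]. *)
Definition smooth_on (R : realType) (n : nat) (A : set 'rV[R]_n.+1)
    (f : 'rV[R]_n.+1 -> R) : Prop :=
  exists (U : set 'rV[R]_n.+1) (F : 'rV[R]_n.+1 -> R),
    [/\ open U, A `<=` U, smooth_open U F & forall x, A x -> F x = f x].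

(* Main.v *)
Require Import Defs.
From mathcomp Require Import ring lra measurable_realfun.
Set Implicit Arguments.
Unset Strict Implicit.
Unset Printing Implicit Defensive.

(** Put h = d/2. Expanding (1 - x t)^(alpha - beta) in its binomial series and
    integrating termwise against t^(gamma - alpha - 1) (1 - t)^(beta - h - 1),
    whose moments satisfy the Beta recursion, gives for all x in [0, 1], the
    endpoint 1 included,
      2F1(beta - alpha, gamma - alpha; beta - alpha + gamma - h; x) = H_x / H_0,
      H_x = int_0^1 t^(gamma - alpha - 1) (1 - t)^(beta - h - 1)
                    (1 - x t)^(alpha - beta) dt.
    As functions of y = (alpha, beta, gamma), H_x and the Gamma factors are Laplace
    transforms int w(t) exp <y, L(t)> dt, with L made of logarithms, hence smooth
    on the open set h < alpha < min(beta, gamma), which contains the parameter set;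
    so is the covariance, for each fixed x in ]0, 1].
    In r and in a, the covariance is a power of x times a power series in x with
    nonnegative coefficients that is summable at x = 1: it is smooth for x in
    ]0, 1[ and continuous on [0, 1]. *)

Local Open Scope classical_set_scope.
Local Open Scope ring_scope.

(** * Smooth functions closed under sums, products and composition *)

(** Derivatives of every order, mixed ones included, are reached without ever being written down:
    the functions at hand lie in a class that contains its own derivatives, so one step of
    differentiation, iterated, settles all orders. Laplace transforms suit this because
    differentiating a moment in the coordinate [i] only inserts the factor [L i] under the integral.
    Differentiating the hypergeometric series termwise in its parameters would instead require
    bounds on derivatives of quotients of rising factorials, up to the endpoint x = 1. At x = 1 the
    factor (1 - x t)^(alpha - beta) is singular at t = 1; combined with (1 - t)^(beta - h - 1) it
    becomes (1 - t)^(alpha - h - 1), which is integrable because alpha > h. One domination therefore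
    serves all x in [0, 1]. For r = a the base x of the power vanishes, and continuity there comes
    from the positivity of the exponent, which the parameter set guarantees for d >= 1 but the
    larger open set does not. *)

Lemma is_derive_line (R : realType) (V : normedModType R) (f : V -> R)
    (x v : V) (df : R) :
  is_derive x v f df <-> is_derive (0 : R) 1 (fun h : R => f (h *: v + x)) df.
Proof.
have e : 'D_v f x = 'D_1 (fun h : R => f (h *: v + x)) 0.
  rewrite /derive; set g1 := fun h => h^-1 *: _; set g2 := fun h => h^-1 *: _.
  suff -> : g1 = g2 by [].
  by apply/funext => h; rewrite /g1 /g2 /= addr0 scale0r add0r [_%:A]mulr1.
split=> [[df1 df2]|[df1 df2]]; split.
- exact: (derivable1P _ _ _).1.
- by rewrite -e.
- exact: (derivable1P _ _ _).2.
- by rewrite e.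
Qed.

(** Restriction to the line through [x] directed by [v] reduces this to the chain rule in one real
    variable. *)
Lemma is_derive_compV (R : realType) (V : normedModType R) (u : R -> R)
    (f : V -> R) (x v : V) (du df : R) :
  is_derive (f x) 1 u du -> is_derive x v f df ->
  is_derive x v (u \o f) (du * df).
Proof.
move=> hu /is_derive_line hf; apply/is_derive_line.
apply: (@is_derive1_comp _ u (fun h : R => f (h *: v + x))).
by rewrite scale0r add0r.
Qed.

Lemma is_derive_continuous (R : realType) (f : R -> R) (x df : R) :
  is_derive x 1 f df -> {for x, continuous f}.
Proof.
by case=> df1 _; apply/differentiable_continuous/derivable1_diffP.
Qed.

Section SmoothClosure.
Context {R : realType} {V : normedModType R}.
Variables (U : set V) (E : set V) (S : set (V -> R)).

(* [sc_comp] is stated for a whole tower [u] of successive derivatives, which is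
   what makes the closure stable under derivation. *)
Inductive smooth_closure : (V -> R) -> Prop :=
| sc_gen f : S f -> smooth_closure f
| sc_cst c : smooth_closure (cst c)
| sc_add f g :
    smooth_closure f -> smooth_closure g -> smooth_closure (fun x => f x + g x)
| sc_mul f g :
    smooth_closure f -> smooth_closure g -> smooth_closure (fun x => f x * g x)
| sc_comp (u : nat -> R -> R) k f :
    smooth_closure f ->
    (forall x, U x -> forall n, is_derive (f x) 1 (u n) (u n.+1 (f x))) ->
    smooth_closure (fun x => u k (f x)).

(** [E] is the set of directions of differentiation: 1 on the real line, the coordinate vectors in
    the parameter space. The derivative of a generator has to lie in the closure only, not among the
    generators. *)
Definition derivation_stable :=
  forall f, S f -> (forall x, U x -> {for x, continuous f}) /\
    forall v, E v -> exists2 g, smooth_closure g &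
      forall x, U x -> is_derive x v f (g x).

Hypothesis HS : derivation_stable.

Lemma smooth_closure_continuous f x :
  smooth_closure f -> U x -> {for x, continuous f}.
Proof.
move=> sf; elim: sf x => {f}.
- by move=> f /HS[cf _] x /cf.
- by move=> c x _; exact: cst_continuous.
- by move=> f g _ cf _ cg x Ux; apply: continuousD; [exact: cf|exact: cg].
- by move=> f g _ cf _ cg x Ux; apply: continuousM; [exact: cf|exact: cg].
- move=> u k f _ cf hu x Ux; apply: (@continuous_comp _ _ _ f (u k)).
    exact: cf.
  exact: is_derive_continuous (hu x Ux k).
Qed.

Lemma smooth_closure_derive f v : smooth_closure f -> E v ->
  exists2 g, smooth_closure g & forall x, U x -> is_derive x v f (g x).
Proof.
move=> sf Ev; elim: sf => {f}.
- by move=> f /HS[_ /(_ _ Ev)].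
- by move=> c; exists (cst 0); [exact: sc_cst|move=> x _; exact: is_derive_cst].
- move=> f g _ [f' sf' hf] _ [g' sg' hg]; exists (fun x => f' x + g' x).
    exact: sc_add.
  move=> x Ux; have := hf x Ux; have := hg x Ux => ? ?.
  exact: (@is_deriveD _ _ _ f g).
- move=> f g sf [f' sf' hf] sg [g' sg' hg].
  exists (fun x => f x * g' x + g x * f' x).
    by apply: sc_add; exact: sc_mul.
  move=> x Ux; have := hf x Ux; have := hg x Ux => ? ?.
  exact: (@is_deriveM _ _ f g).
- move=> u k f sf [f' sf' hf] hu; exists (fun x => u k.+1 (f x) * f' x).
    by apply: sc_mul => //; exact: (@sc_comp u k.+1 f).
  by move=> x Ux; apply: (@is_derive_compV _ _ (u k)); [exact: hu|exact: hf].
Qed.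

End SmoothClosure.

Lemma near_open (T : topologicalType) (U : set T) (x : T) (P : T -> Prop) :
  open U -> U x -> (forall y, U y -> P y) -> \near x, P x.
Proof. by move=> oU Ux UP; apply: filterS UP _; exact: open_nbhs_nbhs. Qed.

Lemma smooth_closure_itv (R : realType) (I : interval R) (S : set (R -> R))
    (f : R -> R) :
  open [set` I] -> derivation_stable [set` I] [set 1] S ->
  smooth_closure [set` I] S f -> smooth_itv I f.
Proof.
move=> oI HS sf.
(* The iterated derivative agrees with a member of the class on [I] only; openness of [I] allows
   this equality to be differentiated again. *)
have H n : exists2 g, smooth_closure [set` I] S g &
    forall x, x \in I -> derive1n n f x = g x.
  elim: n => [|n [g sg hg]]; first by exists f.
  have [g' sg' hg'] := smooth_closure_derive HS sg (erefl : [set (1 : R)] 1).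
  exists g' => // x xI; rewrite derive1nS derive1E.
  have [_ <-] := hg' x xI; apply: near_eq_derive.
  exact: near_open oI xI _.
move=> n x xI; have [g sg hg] := H n.
have [g' _ hg'] := smooth_closure_derive HS sg (erefl : [set (1 : R)] 1).
have [dg _] := hg' x xI; apply: near_eq_derivable dg.
by apply: near_open oI xI _ => y yI; rewrite hg.
Qed.

Lemma smooth_closure_open (R : realType) (n : nat) (U : set 'rV[R]_n.+1)
    (S : set ('rV[R]_n.+1 -> R)) (f : 'rV[R]_n.+1 -> R) :
  open U -> derivation_stable U (range (@delta_mx R 1 n.+1 0)) S ->
  smooth_closure U S f -> smooth_open U f.
Proof.
move=> oU HS sf.
have H s : exists2 g, smooth_closure U S g &
    forall x, U x -> foldr (@partial R n) f s x = g x.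
  elim: s => [|i s [g sg hg]]; first by exists f.
  have [g' sg' hg'] := smooth_closure_derive HS sg (imageT _ i).
  exists g' => // x xU /=; rewrite /partial.
  by have [_ <-] := hg' x xU; apply: near_eq_derive; exact: near_open oU xU _.
move=> s x xU; have [g sg hg] := H s.
have e : \near x, g x = foldr (@partial R n) f s x.
  by apply: near_open oU xU _ => y yU; rewrite hg.
split.
  have cg := smooth_closure_continuous HS sg xU.
  apply: (@cvg_trans _ (g @ x)); first exact: near_eq_cvg e.
  rewrite (_ : foldr (@partial R n) f s x = g x); last exact: hg.
  exact: cg.
move=> i; have [g' _ hg'] := smooth_closure_derive HS sg (imageT _ i).
by have [dg _] := hg' x xU; apply: near_eq_derivable dg.
Qed.

(** * Laplace transforms *)

(** Division by h leaves a remainder of size K |h|. In this form a pointwise bound under an integral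
    sign becomes a derivative of the integral with no exchange of limits. *)
Lemma is_derive_quadratic (R : realType) (V : normedModType R) (f : V -> R)
    (x v : V) (l e K : R) : 0 < e ->
  (forall h, `|h| <= e -> `|f (h *: v + x) - f x - h * l| <= K * h ^+ 2) ->
  is_derive x v f l.
Proof.
move=> e0 H.
have cv : h^-1 *: (f (h *: v + x) - f x) @[h --> (0 : R)^'] --> l.
  apply/cvgrPdist_le => eps eps0.
  near=> h.
  have h0 : h != 0 by near: h; exact: nbhs_dnbhs_neq.
  have he : `|h| <= e.
    near: h; apply: dnbhs0_le; exact: e0.
  (* [K] carries no sign hypothesis; |K| + 1 is a positive bound for it. *)
  have hK : `|h| <= eps / (`|K| + 1).
    by near: h; apply: dnbhs0_le; rewrite divr_gt0// ltr_wpDl.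
  have -> : l - h^-1 *: (f (h *: v + x) - f x) =
      - (h^-1 * (f (h *: v + x) - f x - h * l)).
    by rewrite [_ *: _]mulrC; field.
  rewrite normrN normrM normfV.
  have hp : 0 < `|h| by rewrite normr_gt0.
  rewrite ler_pdivrMl//; apply: le_trans (H _ he) _.
  rewrite -[h ^+ 2]real_normK ?num_real//.
  have := ler_norm K; move: hK; rewrite ler_pdivlMr ?ltr_wpDl// => hK Kn.
  have : K * `|h| ^+ 2 <= `|K| * `|h| ^+ 2 by rewrite ler_wpM2r// exprn_ge0.
  move/le_trans; apply; rewrite expr2 mulrCA ler_pM2l//.
  by apply: le_trans hK; rewrite mulrC ler_pM2l// lerDl.
split; first by apply/cvg_ex; exists l.
exact: cvg_lim.
Unshelve. all: by end_near. Qed.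

Lemma continuous_lipschitz_at (R : realType) (V : normedModType R) (f : V -> R)
    (x : V) (e K : R) : 0 < e ->
  (forall y, `|y - x| <= e -> `|f y - f x| <= K * `|y - x|) ->
  {for x, continuous f}.
Proof.
move=> e0 H; apply/cvgrPdist_le => eps eps0; near=> y.
have ye : `|y - x| <= e by rewrite distrC; near: y; exact: cvgr_dist_le.
have yK : `|y - x| <= eps / (`|K| + 1).
  rewrite distrC; near: y; apply: cvgr_dist_le => //.
  by rewrite divr_gt0// ltr_wpDl.
rewrite distrC; apply: le_trans (H _ ye) _.
apply: (@le_trans _ _ (`|K| * `|y - x|)); first by rewrite ler_wpM2r// ler_norm.
move: yK; rewrite ler_pdivlMr ?ltr_wpDl//; apply: le_trans.
by rewrite mulrDr mulr1 mulrC lerDl.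
Unshelve. all: by end_near. Qed.

Lemma expR_sub1_le (R : realType) (u : R) : `|expR u - 1| <= `|u| * expR `|u|.
Proof.
have [u0|u0] := leP 0 u.
  rewrite !ger0_norm//; last by rewrite subr_ge0 -expR0 ler_expR.
  have := expR_ge1Dx (- u); have := expR_gt0 u => p q.
  have : expR u * (1 - u) <= expR u * expR (- u) by rewrite ler_pM2l.
  by rewrite -expRD subrr expR0; nra.
rewrite (ltr0_norm u0) ler0_norm; last first.
  by rewrite subr_le0 -expR0 ler_expR ltW.
have := expR_ge1Dx u; have : 1 <= expR (- u) by rewrite -expR0 ler_expR; lra.
by nra.
Qed.

(** For u >= 0 the previous bound serves twice: exp u - 1 - u <= u (exp u - 1) <= u^2 exp u. For u <
    0, exp u <= 1 / (1 - u) leaves at most u^2 / (1 - u) <= u^2. *)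
Lemma expR_sub1x_le (R : realType) (u : R) :
  `|expR u - 1 - u| <= u ^+ 2 * expR `|u|.
Proof.
have := expR_ge1Dx u => h1; rewrite ger0_norm; last lra.
have := expR_sub1_le u; have [u0|u0] := leP 0 u.
  rewrite !ger0_norm//; last by rewrite subr_ge0 -expR0 ler_expR.
  by have := expR_gt0 u; nra.
rewrite (ltr0_norm u0) => _.
have := expR_ge1Dx (- u) => h2; have e0 := expR_gt0 u.
have : expR u * (1 - u) <= expR u * expR (- u) by rewrite ler_pM2l.
rewrite -expRD subrr expR0 => h3.
have h4 : 1 <= expR (- u) by lra.
have : u ^+ 2 <= u ^+ 2 * expR (- u) by rewrite ler_peMr ?sqr_ge0.
apply: le_trans; have : expR u * (1 - u) <= 1 by lra.
have : 1 - u > 0 by lra.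
nra.
Qed.

Section DominatedIntegral.
Context {R : realType}.
Local Notation mu := (@lebesgue_measure R).
Variables (D : set (measurableTypeR R)) (f g : measurableTypeR R -> R).
Hypotheses (mD : measurable D) (mf : measurable_fun D f).
Hypothesis ig : mu.-integrable D (EFin \o g).

Lemma integrable_dominated c : (forall t, D t -> `|f t| <= c * g t) ->
  mu.-integrable D (EFin \o f).
Proof.
move=> fg; have icg : mu.-integrable D (EFin \o (fun t => c * g t)).
  have := integrableZl mD c ig; apply: eq_integrable => // t _ /=.
apply: le_integrable icg => //; first exact/measurable_EFinP.
by move=> t Dt /=; rewrite lee_fin (le_trans (fg t Dt))// ler_norm.
Qed.

Lemma Rintegral_dominated c : (forall t, D t -> `|f t| <= c * g t) ->
  `|\int[mu]_(t in D) f t| <= c * \int[mu]_(t in D) g t.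
Proof.
move=> fg; have if_ := integrable_dominated fg.
apply: le_trans (le_normr_Rintegral mD if_) _.
rewrite -RintegralZl//; apply: le_Rintegral => //.
  exact: integrable_norm if_.
have := integrableZl mD c ig; apply: eq_integrable => // t _ /=.
Qed.

End DominatedIntegral.

Section Laplace.
Context {R : realType} {n : nat}.
Local Notation mu := (@lebesgue_measure R).
Variables (D : set (measurableTypeR R)) (w : measurableTypeR R -> R)
  (L : 'I_n.+1 -> measurableTypeR R -> R).
Hypotheses (mD : measurable D) (mw : measurable_fun D w)
  (mL : forall i, measurable_fun D (L i)) (w0 : forall t, D t -> 0 <= w t).

Definition laplace_exponent (x : 'rV[R]_n.+1) (t : R) : R :=
  \sum_i x 0 i * L i t.

Definition laplace_norm (t : R) : R := \sum_i `|L i t|.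

(** At dominated points this is the mixed partial derivative along [s] of the Laplace transform,
    which is the case of the empty list. *)
Definition laplace_moment (s : seq 'I_n.+1) (x : 'rV[R]_n.+1) : R :=
  \int[mu]_(t in D)
    (w t * \prod_(i <- s) L i t * expR (laplace_exponent x t)).

(** The margin [e] pays both for moving [x] in a ball and for the powers of the [L i] that
    differentiation brings down. *)
Definition laplace_dominated (x : 'rV[R]_n.+1) : Prop :=
  exists2 e, 0 < e & mu.-integrable D
    (EFin \o (fun t => w t * expR (laplace_exponent x t + e * laplace_norm t))).

Local Notation l := laplace_norm.

Lemma laplace_norm_ge0 t : 0 <= l t.
Proof. by apply: sumr_ge0 => i _. Qed.

Lemma laplace_exponentD x y t :
  laplace_exponent (x + y) t = laplace_exponent x t + laplace_exponent y t.
Proof.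
rewrite -big_split/=; apply: eq_bigr => i _; by rewrite mxE mulrDl.
Qed.

Lemma laplace_exponent_delta (h : R) i t :
  laplace_exponent (h *: delta_mx 0 i) t = h * L i t.
Proof.
rewrite /laplace_exponent (bigD1 i)//= big1 ?addr0 => [|j ji].
  by rewrite !mxE !eqxx mulr1.
by rewrite !mxE (negbTE ji) andbF mulr0 mul0r.
Qed.

(** Hölder's inequality: row vectors carry the sup norm, which is why margins are measured by the
    sum of the |L i|. *)
Lemma laplace_exponent_le x t :
  `|laplace_exponent x t| <= `|x| * l t.
Proof.
rewrite /laplace_norm mulr_sumr; apply: le_trans (ler_norm_sum _ _ _) _.
apply: ler_sum => i _; rewrite normrM ler_wpM2r//.
rewrite [leRHS]/Num.norm/= mx_normrE.
exact: (@le_bigmax _ _ _ 0 (fun ij => `|x ij.1 ij.2|) (0, i)).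
Qed.

Lemma laplace_norm_prod s t : `|\prod_(i <- s) L i t| <= l t ^+ size s.
Proof.
elim: s => [|i s IH] /=; first by rewrite big_nil normr1 expr0.
rewrite big_cons normrM exprS ler_pM// /laplace_norm (bigD1 i)//= lerDl.
by apply: sumr_ge0.
Qed.

Lemma measurable_laplace_exponent x : measurable_fun D (laplace_exponent x).
Proof.
apply: measurable_sum => i; apply: measurable_funM => //.
Qed.

Lemma measurable_laplace_norm : measurable_fun D l.
Proof. by apply: measurable_sum => i; exact: measurableT_comp. Qed.

Lemma measurable_laplace_prod s : measurable_fun D (fun t => \prod_(i <- s) L i t).
Proof.
elim: s => [|i s IH]; first by under eq_fun do rewrite big_nil; exact: measurable_cst.
by under eq_fun do rewrite big_cons; apply: measurable_funM.
Qed.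

Lemma measurable_laplace_integrand s x : measurable_fun D
  (fun t => w t * \prod_(i <- s) L i t * expR (laplace_exponent x t)).
Proof.
apply: measurable_funM.
  by apply: measurable_funM => //; exact: measurable_laplace_prod.
by apply: measurableT_comp => //; exact: measurable_laplace_exponent.
Qed.

(* Shrinking the margin [e] to [e / (k + 1)] absorbs [k] powers of the norm, since
   [y <= expR y]. *)
Lemma laplace_dominated_power x k : laplace_dominated x ->
  exists2 e, 0 < e & mu.-integrable D
    (EFin \o (fun t => w t * (l t ^+ k * expR (laplace_exponent x t + e * l t)))).
Proof.
move=> [e e0 ie]; pose e' := e / k.+1%:R.
have e'0 : 0 < e' by rewrite divr_gt0.
exists e' => //; apply: (integrable_dominated mD _ ie (c := e' ^- k)).
  apply: measurable_funM => //; apply: measurable_funM.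
    by apply: measurable_funX; exact: measurable_laplace_norm.
  apply: measurableT_comp => //; apply: measurable_funD.
    exact: measurable_laplace_exponent.
  by apply: measurable_funM => //; exact: measurable_laplace_norm.
move=> t Dt; have l0 := laplace_norm_ge0 t.
rewrite ger0_norm; last by rewrite !mulr_ge0 ?w0 ?exprn_ge0 ?expR_ge0.
rewrite [leRHS]mulrCA ler_wpM2l ?w0// !expRD mulrCA [leRHS]mulrCA.
rewrite ler_wpM2l ?expR_ge0//.
rewrite ler_pdivlMl ?exprn_gt0// mulrA -exprMn.
have -> : e * l t = (e' * l t) *+ k.+1.
  by rewrite -mulr_natr mulrAC /e' divfK// pnatr_eq0.
rewrite mulrSr expRD ler_wpM2r ?expR_ge0// -mulr_natl expRM_natl.
have y0 : 0 <= e' * l t by rewrite mulr_ge0// ltW.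
by apply: lerXn2r; rewrite ?nnegrE ?expR_ge0//; have := expR_ge1Dx (e' * l t); lra.
Qed.

Lemma laplace_integrable s x : laplace_dominated x ->
  mu.-integrable D (EFin \o (fun t =>
    w t * \prod_(i <- s) L i t * expR (laplace_exponent x t))).
Proof.
move=> /(laplace_dominated_power (size s))[e e0 ie].
apply: (integrable_dominated mD _ ie (c := 1)).
  exact: measurable_laplace_integrand.
move=> t Dt; rewrite mul1r !normrM (ger0_norm (w0 Dt)) (ger0_norm (expR_ge0 _)).
rewrite -mulrA ler_wpM2l ?w0// ler_pM ?expR_ge0//; first exact: laplace_norm_prod.
by rewrite ler_expR lerDl mulr_ge0 ?laplace_norm_ge0// ltW.
Qed.

(** Half of the margin pays for the displacement, the other half is the new margin. *)
Lemma laplace_dominated_near x : laplace_dominated x ->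
  exists2 e, 0 < e & forall y, `|y| <= e -> laplace_dominated (y + x).
Proof.
move=> [e e0 ie]; exists (e / 2) => [|y ye]; first by rewrite divr_gt0.
exists (e / 2); first by rewrite divr_gt0.
apply: (integrable_dominated mD _ ie (c := 1)).
  apply: measurable_funM => //; apply: measurableT_comp => //.
  apply: measurable_funD; first exact: measurable_laplace_exponent.
  by apply: measurable_funM => //; exact: measurable_laplace_norm.
move=> t Dt; rewrite mul1r normrM (ger0_norm (w0 Dt)) (ger0_norm (expR_ge0 _)).
rewrite ler_wpM2l ?w0// ler_expR laplace_exponentD.
have := laplace_exponent_le y t; have := ler_norm (laplace_exponent y t).
have : `|y| * l t <= e / 2 * l t by rewrite ler_wpM2r ?laplace_norm_ge0.
by rewrite [in e * _](_ : e = e / 2 + e / 2) ?mulrDl; lra.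
Qed.

(** With a = L i t, the increment minus its linear part brings exp (h a) - 1 - h a under the
    integral, which is at most h^2 times a function integrable after multiplication by the other
    factors. Its square a^2 is the reason for two powers of the norm beyond those of [s]. *)
Lemma laplace_moment_derive s x i : laplace_dominated x ->
  is_derive x (delta_mx 0 i) (laplace_moment s) (laplace_moment (i :: s) x).
Proof.
move=> dx; have [e1 e10 near_dom] := laplace_dominated_near dx.
have [e2 e20 ie2] := laplace_dominated_power (size s).+2 dx.
pose e := Num.min e1 e2.
have e0 : 0 < e by rewrite lt_min e10.
apply: (is_derive_quadratic e0) => h; rewrite le_min => /andP[he1 he2].
(* The displaced point must be dominated too: linearity of the integral is used on its integrand. *)
have dhx : laplace_dominated (h *: delta_mx 0 i + x).
  apply: near_dom; rewrite normrZ.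
  apply: le_trans he1; rewrite ler_piMr//.
  rewrite [leLHS]/Num.norm/= mx_normrE; apply: bigmax_le => // -[a b] _ /=.
  by rewrite mxE; case: (_ && _); rewrite ?normr1 ?normr0.
have := laplace_integrable s dhx; have := laplace_integrable s dx.
have := laplace_integrable (i :: s) dx => I1 I2 I3.
rewrite /laplace_moment -RintegralB// -RintegralZl// -RintegralB//; last 2 first.
- have := integrableB mD I3 I2; apply: eq_integrable => // t _ /=.
- have := integrableZl mD h I1; apply: eq_integrable => // t _ /=.
rewrite mulrC.
apply: (Rintegral_dominated mD _ ie2).
  apply: measurable_funB.
    by apply: measurable_funB; exact: measurable_laplace_integrand.
  by apply: measurable_funM => //; exact: measurable_laplace_integrand.
move=> t Dt; rewrite laplace_exponentD laplace_exponent_delta big_cons.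
set p := \prod_(_ <- _) _; set E := laplace_exponent x t; set a := L i t.
have -> : w t * p * expR (h * a + E) - w t * p * expR E
    - h * (w t * (a * p) * expR E) =
    w t * (p * expR E * (expR (h * a) - 1 - h * a)).
  by rewrite expRD; ring.
rewrite normrM (ger0_norm (w0 Dt)) mulrCA ler_wpM2l ?w0//.
rewrite normrM normrM (ger0_norm (expR_ge0 _)) expRD.
have lt0 := laplace_norm_ge0 t.
have al : `|a| <= l t by rewrite /laplace_norm (bigD1 i)//= lerDl sumr_ge0.
have pl : `|p| <= l t ^+ size s by exact: laplace_norm_prod.
(* As |h| <= e2, the factor exp |h a| fits into the margin exp (e2 l). *)
have q : `|expR (h * a) - 1 - h * a| <= h ^+ 2 * (l t ^+ 2 * expR (e2 * l t)).
  apply: le_trans (expR_sub1x_le _) _; rewrite exprMn -mulrA ler_wpM2l ?sqr_ge0//.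
  apply: ler_pM; rewrite ?sqr_ge0 ?expR_ge0//.
    by rewrite -[a ^+ 2]real_normK ?num_real// ler_sqr.
  by rewrite ler_expR normrM ler_pM.
rewrite -[(size s).+2]addn2 (exprD (l t)).
have -> : h ^+ 2 * (l t ^+ size s * l t ^+ 2 * (expR E * expR (e2 * l t))) =
  l t ^+ size s * expR E * (h ^+ 2 * (l t ^+ 2 * expR (e2 * l t))) by ring.
by apply: ler_pM => //; rewrite ?mulr_ge0 ?expR_ge0// ler_wpM2r ?expR_ge0.
Qed.

Lemma laplace_moment_continuous s x : laplace_dominated x ->
  {for x, continuous (laplace_moment s)}.
Proof.
move=> dx; have [e1 e10 near_dom] := laplace_dominated_near dx.
have [e2 e20 ie2] := laplace_dominated_power (size s).+1 dx.
pose e := Num.min e1 e2.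
have e0 : 0 < e by rewrite lt_min e10.
apply: (continuous_lipschitz_at e0) => y; rewrite le_min => /andP[he1 he2].
have dy : laplace_dominated y by rewrite -(subrK x y); exact: near_dom.
have := laplace_integrable s dy; have := laplace_integrable s dx => I1 I2.
rewrite /laplace_moment -RintegralB// mulrC.
apply: (Rintegral_dominated mD _ ie2).
  by apply: measurable_funB; exact: measurable_laplace_integrand.
move=> t Dt; rewrite -{1}(subrK x y) laplace_exponentD.
set p := \prod_(_ <- _) _; set E := laplace_exponent x t.
set u := laplace_exponent (y - x) t.
have -> : w t * p * expR (u + E) - w t * p * expR E =
    w t * (p * expR E * (expR u - 1)).
  by rewrite expRD; ring.
rewrite normrM (ger0_norm (w0 Dt)) mulrCA ler_wpM2l ?w0//.
rewrite normrM normrM (ger0_norm (expR_ge0 _)) expRD.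
have lt0 := laplace_norm_ge0 t.
have pl : `|p| <= l t ^+ size s by exact: laplace_norm_prod.
have ul : `|u| <= `|y - x| * l t by exact: laplace_exponent_le.
have q : `|expR u - 1| <= `|y - x| * (l t * expR (e2 * l t)).
  apply: le_trans (expR_sub1_le _) _; rewrite mulrA.
  by rewrite ler_pM ?expR_ge0// ler_expR (le_trans ul)// ler_wpM2r.
rewrite exprSr.
have -> : `|y - x| * (l t ^+ size s * l t * (expR E * expR (e2 * l t))) =
  l t ^+ size s * expR E * (`|y - x| * (l t * expR (e2 * l t))) by ring.
by apply: ler_pM => //; rewrite ?mulr_ge0 ?expR_ge0// ler_wpM2r ?expR_ge0.
Qed.

End Laplace.

(** * Improper integrals *)

(** A positive function of integral 0 would vanish almost everywhere on [D], so that [D] would lie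
    in a null set. *)
Lemma Rintegral_gt0 (R : realType) (D : set (measurableTypeR R))
    (f : measurableTypeR R -> R) :
  measurable D -> (0 < lebesgue_measure D)%E -> (forall t, D t -> 0 < f t) ->
  (@lebesgue_measure R).-integrable D (EFin \o f) ->
  0 < \int[@lebesgue_measure R]_(t in D) f t.
Proof.
move=> mD D0 f0 if_; rewrite lt_neqAle Rintegral_ge0 ?andbT; last first.
  by move=> t /f0/ltW.
apply/eqP => /esym I0; have mf := measurable_int _ if_.
have : (\int[@lebesgue_measure R]_(t in D) `|(EFin \o f) t| = 0)%E.
  have e : (\int[@lebesgue_measure R]_(t in D) `|(EFin \o f) t| =
      \int[@lebesgue_measure R]_(t in D) (EFin \o f) t)%E.
    apply: eq_integral => t; rewrite inE => Dt /=.
    by rewrite gtr0_norm// f0.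
  rewrite e -[LHS]fineK; last exact: integrable_fin_num.
  by rewrite [X in X%:E]I0.
move/(ae_eq_integral_abs _ mD mf) => [N [mN N0 DN]].
have DsubN : D `<=` N.
  move=> t Dt; apply: DN => /= /(_ Dt) [] ft0.
  by have := f0 t Dt; rewrite ft0 ltxx.
have DN0 := le_measure (@lebesgue_measure R) (mem_set mD) (mem_set mN) DsubN.
have : (0 < 0 :> \bar R)%E.
  apply: (lt_le_trans D0); apply: (le_trans DN0).
  by rewrite le_eqVlt; apply/orP; left; apply/eqP; exact: N0.
by rewrite ltxx.
Qed.

Section ImproperFTC.
Context {R : realType}.
Local Notation mu := (@lebesgue_measure R).
Variables (D : set (measurableTypeR R)) (a_ b_ : nat -> R) (F f : R -> R).
Hypotheses (ab : forall n, a_ n < b_ n)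
  (nda : nonincreasing_seq a_) (ndb : nondecreasing_seq b_)
  (DE : D = \bigcup_n [set` `[a_ n, b_ n]]).
Hypotheses (dF : forall x, D x -> is_derive x 1 F (f x))
  (cf : forall x, D x -> {for x, continuous f}).

Let D_sub n : `[a_ n, b_ n] `<=` D.
Proof. by rewrite DE => x xn; exists n. Qed.

Let mD : measurable D.
Proof. by rewrite DE; apply: bigcupT_measurable => n; exact: measurable_itv. Qed.

Let cfn n : {within `[a_ n, b_ n], continuous f}.
Proof.
apply: continuous_in_subspaceT => x; rewrite inE => xn.
by apply: cf; exact: D_sub xn.
Qed.

Let measurable_derivative n :
  measurable_fun (`[a_ n, b_ n] : set (measurableTypeR R)) f.
Proof.
by apply: subspace_continuous_measurable_fun => //; exact: cfn.
Qed.

Lemma measurable_improper : measurable_fun D f.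
Proof.
by rewrite DE; apply/measurable_fun_bigcup => n //; exact: measurable_derivative.
Qed.

Lemma integral_exhaustion n :
  (\int[mu]_(x in `[a_ n, b_ n]) (f x)%:E = (F (b_ n) - F (a_ n))%:E)%E.
Proof.
have dFn x : x \in `[a_ n, b_ n] -> is_derive x 1 F (f x).
  by move=> xn; apply: dF; exact: (D_sub xn).
rewrite EFinB; apply: continuous_FTC2 => //.
- split.
  + move=> x xab; have [//] := dFn x (subset_itv_oo_cc xab).
  + apply: cvg_at_right_filter; apply: is_derive_continuous (dFn _ _).
    by rewrite in_itv/= lexx ltW.
  + apply: cvg_at_left_filter; apply: is_derive_continuous (dFn _ _).
    by rewrite in_itv/= lexx ltW.
- move=> x xab; rewrite derive1E.
  by have [_] := dFn x (subset_itv_oo_cc xab).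
Qed.

Lemma nondecreasing_exhaustion : nondecreasing_seq (fun n => [set` `[a_ n, b_ n]]).
Proof.
move=> m n mn; rewrite subsetEset; apply: subset_itv; rewrite bnd_simp.
  exact: nda.
exact: ndb.
Qed.

(** Over the exhausting segments the integral is an increment of [F], hence at most 2 K; monotone
    convergence carries the bound to [D]. *)
Lemma ge0_improper_integrable K : (forall x, D x -> 0 <= f x) ->
  (forall x, D x -> `|F x| <= K) -> mu.-integrable D (EFin \o f).
Proof.
move=> f0 FK; apply/integrableP; split.
  by apply/measurable_EFinP; exact: measurable_improper.
apply: (@le_lt_trans _ _ (K + K)%:E); last exact: ltry.
rewrite [leLHS](_ : _ = \int[mu]_(x in D) (f x)%:E)%E; last first.
  apply: eq_integral => x; rewrite inE => Dx /=.
  by rewrite ger0_norm// f0.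
have cvI : (\int[mu]_(x in `[a_ n, b_ n]) (f x)%:E @[n --> \oo] -->
    \int[mu]_(x in D) (f x)%:E)%E.
  rewrite DE; apply: (@ge0_nondecreasing_set_cvg_integral _ _ _
    (fun n => [set` `[a_ n, b_ n]] : set (measurableTypeR R)) (EFin \o f) mu).
  - exact: nondecreasing_exhaustion.
  - by move=> n; exact: measurable_itv.
  - by move=> n; apply/measurable_EFinP; exact: measurable_derivative.
  - by move=> n x xn; rewrite lee_fin f0//; exact: D_sub xn.
rewrite -(cvg_lim _ cvI)//; apply: lime_le; first exact: cvgP cvI.
apply: nearW => n; rewrite integral_exhaustion lee_fin.
have Da : D (a_ n) by apply: (@D_sub n); rewrite /= in_itv/= lexx ltW.
have Db : D (b_ n) by apply: (@D_sub n); rewrite /= in_itv/= lexx ltW.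
by apply: le_trans (ler_norm _) _; apply: le_trans (ler_normB _ _) _;
  apply: lerD; exact: FK.
Qed.

(** No sign is assumed on [f]: the truncations to the segments converge under the domination of
    |f|. *)
Lemma improper_FTC l : mu.-integrable D (EFin \o f) ->
  (F (b_ n) - F (a_ n)) @[n --> \oo] --> l -> \int[mu]_(x in D) f x = l.
Proof.
move=> if_ Fl.
pose f_ n := ((EFin \o f) \_ [set` `[a_ n, b_ n]])%E.
have mfn n : measurable_fun D (f_ n).
  apply: (measurable_restrict (EFin \o f : measurableTypeR R -> \bar R)
    (measurable_itv _) mD).1.
  by apply: measurable_funS (measurable_int _ if_) => //; exact: subIsetl.
have H : (\int[mu]_(x in D) f_ n x @[n --> \oo] -->
    \int[mu]_(x in D) (EFin \o f) x)%E.
  have [|||_ _ //] := @dominated_convergence _ _ _ mu D mD f_ (EFin \o f)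
    (fun x => `|(EFin \o f) x|)%E mfn (measurable_int _ if_).
  - apply: aeW => x Dx; apply: cvg_near_cst.
    have : D x by []; rewrite {1}DE => -[N _ xN].
    near=> n; rewrite /f_ patchE mem_set//.
    have : [set` `[a_ N, b_ N]] `<=` [set` `[a_ n, b_ n]].
      have /nondecreasing_exhaustion : (N <= n)%N by near: n; exact: nbhs_infty_ge.
      by rewrite subsetEset.
    exact.
  - exact: integrable_abse.
  - apply: aeW => x n Dx; rewrite /f_ patchE.
    by case: ifPn => // _; rewrite abse0 abse_ge0.
have E n : (\int[mu]_(x in D) f_ n x = (F (b_ n) - F (a_ n))%:E)%E.
  rewrite -integral_exhaustion /f_ -integral_mkcondr.
  by congr (integral _ _ _); apply/setIidPr; exact: D_sub.
rewrite /Rintegral; apply: EFin_inj; rewrite fineK; last first.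
  exact: integrable_fin_num.
move: H; rewrite (funext E) => H; apply: (cvg_unique _ H) => //.
by apply/cvg_EFin; [exact: nearW|exact: Fl].
Unshelve. all: by end_near. Qed.

End ImproperFTC.

(** * The Gamma integral *)

Section Exhaustion.
Context {R : realType}.

(* Starting at 1 / 3 keeps [exhaust_left n] below [1 - exhaust_left n]. *)
Definition exhaust_left (n : nat) : R := n.+3%:R^-1.

Lemma exhaust_left_gt0 n : 0 < exhaust_left n.
Proof. by rewrite invr_gt0. Qed.

Lemma exhaust_left_le n : exhaust_left n <= 3%:R^-1.
Proof. by rewrite lef_pV2 ?posrE// ler_nat. Qed.

Lemma exhaust_left_noninc : nonincreasing_seq exhaust_left.
Proof. by move=> m n mn; rewrite lef_pV2 ?posrE// ler_nat. Qed.

Lemma exhaust_left_small (e : R) : 0 < e -> exists n, exhaust_left n < e.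
Proof.
move=> e0; exists (Num.bound e^-1); rewrite invf_plt ?posrE//.
apply: (lt_le_trans (archi_boundP _)); first by rewrite invr_ge0 ltW.
by rewrite ler_nat -addn3 leq_addr.
Qed.

Lemma exhaust_left_cvg0 : exhaust_left n @[n --> \oo] --> 0.
Proof.
have := @cvg_harmonic R; rewrite -(cvg_shiftn 2) /harmonic /=.
by under eq_fun do rewrite addn2.
Qed.

Lemma itv01_exhaustion : `]0, 1[%classic =
  \bigcup_n `[exhaust_left n, 1 - exhaust_left n]%classic.
Proof.
apply/seteqP; split=> [x/=|x [n _]/=]; last first.
  rewrite !in_itv/= => /andP[x0 x1]; have := exhaust_left_gt0 n; lra.
rewrite in_itv/= => /andP[x0 x1].
have [|n] := @exhaust_left_small (Num.min x (1 - x)).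
  by rewrite lt_min x0 subr_gt0.
by rewrite lt_min => /andP[nx n1x]; exists n => //=; rewrite in_itv/=; lra.
Qed.

Lemma itv0y_exhaustion : `]0, +oo[%classic =
  \bigcup_n `[exhaust_left n, n.+3%:R]%classic.
Proof.
apply/seteqP; split=> [x/=|x [n _]/=]; last first.
  rewrite !in_itv/= => /andP[x0 x1]; have := exhaust_left_gt0 n; lra.
rewrite in_itv/= andbT => x0.
have [|n] := @exhaust_left_small (Num.min x x^-1).
  by rewrite lt_min x0 invr_gt0.
rewrite lt_min ltf_pV2 ?posrE// => /andP[nx n1x]; exists n => //=.
by rewrite in_itv/= !ltW.
Qed.

End Exhaustion.

Section GammaIntegral.
Context {R : realType}.
Local Notation mu := (@lebesgue_measure R).
Local Notation D := (`]0, +oo[%classic : set (measurableTypeR R)).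

Lemma powR_le1 (t p : R) : 0 <= t <= 1 -> 0 < p -> t `^ p <= 1.
Proof.
move=> /andP[t0 t1] p0; have -> : 1 = 1 `^ p :> R by rewrite powR1.
by apply: ge0_ler_powR; rewrite ?nnegrE// ltW.
Qed.

(** Over t > 0 the function x ln t - t is largest at t = x; this is ln s <= s - 1 taken at s = t /
    x. *)
Lemma powR_le_expR (x t : R) : 0 < x -> 0 < t ->
  t `^ x <= expR (x * ln x - x) * expR t.
Proof.
move=> x0 t0; rewrite /powR gt_eqF// -expRD ler_expR.
have := @le_ln1Dx R (t / x - 1).
have -> : 1 + (t / x - 1) = t / x by ring.
have tx : 0 < t / x by rewrite divr_gt0.
rewrite ltrBDl subrr tx => /(_ isT).
rewrite lnM ?posrE ?invr_gt0// lnV ?posrE// => h.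
have : x * (ln t - ln x) <= x * (t / x - 1) by rewrite ler_pM2l.
have -> : x * (t / x - 1) = t - x by field; rewrite gt_eqF.
by rewrite mulrBr; lra.
Qed.

Lemma is_derive_homography (t : R) : 0 < t ->
  is_derive t 1 (fun t : R => t / (1 + t)) ((1 + t) ^- 2).
Proof.
move=> t0; have t1 : 1 + t != 0 by rewrite gt_eqF// ltr_wpDl.
have d1 : is_derive t 1 (fun t : R => 1 + t) 1.
  have := @is_deriveD R R R (cst (1 : R)) id t 1 _ _ (is_derive_cst _ _ _)
    (is_derive_id t 1).
  by rewrite add0r.
have d2 : is_derive t 1 (fun t : R => (1 + t)^-1) (- (1 + t) ^- 2 *: 1).
  exact: is_deriveV.
have := @is_deriveM _ _ id (fun t : R => (1 + t)^-1) t 1 _ _ _ d2.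
move=> /(_ _ (is_derive_id t 1)) h; apply: is_derive_eq h _.
by rewrite /GRing.scale/=; field.
Qed.

(* [(t / (1 + t)) ^ x / x] is a bounded primitive of
   [(t / (1 + t)) ^ (x - 1) / (1 + t) ^ 2], and the Gamma integrand is the latter
   times the bounded function [(1 + t) ^ (x + 1) * expR (- t)]. *)
Lemma Gamma_integrable (x : R) : 0 < x ->
  mu.-integrable D (EFin \o (fun t => t `^ (x - 1) * expR (- t))).
Proof.
move=> x0.
pose F (t : R) := x^-1 * (t / (1 + t)) `^ x.
pose f (t : R) := (t / (1 + t)) `^ (x - 1) * (1 + t) ^- 2.
have dF t : D t -> is_derive t 1 F (f t).
  rewrite /= in_itv/= andbT => t0.
  have q0 : 0 < t / (1 + t) by rewrite divr_gt0// ltr_wpDl.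
  have h := @is_derive1_comp R (fun s : R => s `^ x) (fun t : R => t / (1 + t)) t
    _ _ (is_derive1_powR x q0) (is_derive_homography t0).
  have := is_deriveZ x^-1 h; move/is_derive_eq; apply.
  by rewrite /GRing.scale/= /f mulrA mulrA mulVf ?gt_eqF// mul1r.
have cf t : D t -> {for t, continuous f}.
  rewrite /= in_itv/= andbT => t0.
  have q0 : 0 < t / (1 + t) by rewrite divr_gt0// ltr_wpDl.
  apply: continuousM.
    apply: is_derive_continuous.
    exact: (@is_derive1_comp R (fun s : R => s `^ (x - 1))
      (fun t : R => t / (1 + t)) t _ _ (is_derive1_powR (x - 1) q0)
      (is_derive_homography t0)).
  have t1 : (1 + t) ^+ 2 != 0 by rewrite expf_neq0// gt_eqF// ltr_wpDl.
  apply: (@continuousV _ _ (fun t : R => (1 + t) ^+ 2)) => //.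
  by apply: (@continuousM _ _ (fun t : R => 1 + t) (fun t : R => 1 + t));
    apply: continuousD => //; exact: cst_continuous.
have if_ : mu.-integrable D (EFin \o f).
  apply: (@ge0_improper_integrable R D exhaust_left (fun n => n.+3%:R) F f _ _ _ _
    dF cf x^-1).
  - move=> n; apply: (le_lt_trans (exhaust_left_le n)).
    by rewrite (@lt_le_trans _ _ 1) ?invf_lt1 ?ltr1n// ler1n.
  - exact: exhaust_left_noninc.
  - by move=> m n mn; rewrite ler_nat.
  - exact: itv0y_exhaustion.
  - move=> t; rewrite /= in_itv/= andbT => t0.
    by rewrite mulr_ge0 ?powR_ge0// invr_ge0 sqr_ge0.
  - move=> t; rewrite /= in_itv/= andbT => t0.
    rewrite ger0_norm ?mulr_ge0 ?powR_ge0 ?invr_ge0 ?(ltW x0)//.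
    rewrite ger_pMr ?invr_gt0// powR_le1//.
    rewrite divr_ge0 ?(ltW t0) ?addr_ge0 ?(ltW t0)//=.
    by rewrite ler_pdivrMr ?ltr_wpDl// mul1r lerDr.
have mD : measurable D by exact: measurable_itv.
(* The constant is e times the maximum of s^(x + 1) exp (- s), taken at s = 1 + t. *)
apply: (integrable_dominated mD _ if_
  (c := expR ((x + 1) * ln (x + 1) - (x + 1)) * expR 1)).
  apply: measurable_funM.
    apply: (@measurable_funS _ _ _ _ setT) => //; exact: measurable_powR.
  by apply: measurableT_comp => //; exact: measurable_funN.
move=> t; rewrite /= in_itv/= andbT => t0.
rewrite ger0_norm ?mulr_ge0 ?powR_ge0 ?expR_ge0//.
have t1 : 0 < 1 + t by rewrite ltr_wpDl.
have := powR_le_expR (addr_gt0 x0 ltr01) t1.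
rewrite (expRD 1) mulrA; set K := expR _ * expR 1 => hK.
have -> : t `^ (x - 1) = (1 + t) `^ (x + 1) * f t.
  rewrite /f -(powR_invn 2) ?(ltW t1)//.
  rewrite powRM ?invr_ge0 ?(ltW t0) ?(ltW t1)//.
  rewrite -powR_inv1 ?(ltW t1)// -powRrM -mulrA mulrCA -[LHS]mulr1; congr (_ * _).
  rewrite -!powRD ?(gt_eqF t1) ?implybT//.
  have -> : x + 1 + (-1 * (x - 1) - 2) = 0 by ring.
  by rewrite powRr0.
rewrite mulrAC ler_pM2r; last first.
  by rewrite mulr_gt0 ?powR_gt0 ?divr_gt0// invr_gt0 exprn_gt0.
by rewrite expRN ler_pdivrMr ?expR_gt0.
Qed.

Lemma Gamma_gt0 (x : R) : 0 < x -> 0 < Gamma x.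
Proof.
move=> x0; apply: Rintegral_gt0.
- exact: measurable_itv.
- rewrite lebesgue_measure_itv/= ltry; by rewrite oppr0 addye// ltry.
- move=> t; rewrite /= in_itv/= andbT => t0.
  by rewrite mulr_gt0 ?powR_gt0 ?expR_gt0.
- exact: Gamma_integrable.
Qed.

End GammaIntegral.

(** * The Beta integral *)

Section BetaIntegral.
Context {R : realType}.
Local Notation mu := (@lebesgue_measure R).
Local Notation D := (`]0, 1[%classic : set (measurableTypeR R)).

Definition beta_weight (p q t : R) : R := t `^ (p - 1) * (1 - t) `^ (q - 1).

Definition Beta (p q : R) : R := \int[mu]_(t in D) beta_weight p q t.

Lemma beta_weight_gt0 p q t : t \in `]0, 1[ -> 0 < beta_weight p q t.
Proof.
by rewrite in_itv/= => /andP[t0 t1]; rewrite mulr_gt0 ?powR_gt0 ?subr_gt0.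
Qed.

Lemma measurable_beta_weight p q : measurable_fun D (beta_weight p q).
Proof.
apply: measurable_funM.
  apply: (@measurable_funS _ _ _ _ setT) => //; exact: measurable_powR.
apply: (measurableT_comp (measurable_powR (q - 1))).
exact: measurable_funB.
Qed.

Lemma is_derive_onem_powR (p t : R) : t < 1 ->
  is_derive t 1 (fun s : R => (1 - s) `^ p) (- (p * (1 - t) `^ (p - 1))).
Proof.
move=> t1; have d1 : is_derive t 1 (fun s : R => 1 - s) (-1).
  have := @is_deriveB R R R (cst (1 : R)) id t 1 _ _ (is_derive_cst _ _ _)
    (is_derive_id t 1).
  by rewrite sub0r.
have t10 : 0 < 1 - t by rewrite subr_gt0.
have := @is_derive1_comp R (fun s : R => s `^ p) _ t _ _
  (is_derive1_powR p t10) d1.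
by rewrite mulrN1.
Qed.

Let exhaust_lt (n : nat) : exhaust_left n < 1 - exhaust_left n :> R.
Proof. by have := @exhaust_left_le R n; lra. Qed.

Let exhaust_right_nondec : nondecreasing_seq (fun n => 1 - exhaust_left n : R).
Proof. by move=> m n mn; rewrite lerD2l lerN2; exact: exhaust_left_noninc. Qed.

Lemma powR_integrable01 p : 0 < p ->
  mu.-integrable D (EFin \o (fun t => t `^ (p - 1))).
Proof.
move=> p0; apply: (@ge0_improper_integrable R D exhaust_left
    (fun n => 1 - exhaust_left n) (fun t => p^-1 * t `^ p) _ exhaust_lt
    (@exhaust_left_noninc R) exhaust_right_nondec itv01_exhaustion _ _ p^-1).
- move=> t; rewrite /= in_itv/= => /andP[t0 t1].
  have := @is_deriveZ R R R (fun s : R => s `^ p) p^-1 t 1 _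
    (is_derive1_powR p t0).
  by rewrite /GRing.scale/= mulrA mulVf ?gt_eqF// mul1r.
- move=> t; rewrite /= in_itv/= => /andP[t0 t1].
  exact: is_derive_continuous (is_derive1_powR (p - 1) t0).
- by move=> t _; exact: powR_ge0.
- move=> t; rewrite /= in_itv/= => /andP[t0 t1].
  rewrite ger0_norm ?mulr_ge0 ?powR_ge0 ?invr_ge0 ?(ltW p0)//.
  by rewrite ger_pMr ?invr_gt0// powR_le1// !ltW.
Qed.

Lemma onem_powR_integrable01 q : 0 < q ->
  mu.-integrable D (EFin \o (fun t => (1 - t) `^ (q - 1))).
Proof.
move=> q0; apply: (@ge0_improper_integrable R D exhaust_left
    (fun n => 1 - exhaust_left n) (fun t => - q^-1 * (1 - t) `^ q) _ exhaust_lt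
    (@exhaust_left_noninc R) exhaust_right_nondec itv01_exhaustion _ _ q^-1).
- move=> t; rewrite /= in_itv/= => /andP[t0 t1].
  have := @is_deriveZ R R R (fun s : R => (1 - s) `^ q) (- q^-1) t 1 _
    (is_derive_onem_powR q t1).
  by rewrite /GRing.scale/= mulrNN mulrA mulVf ?gt_eqF// mul1r.
- move=> t; rewrite /= in_itv/= => /andP[t0 t1].
  exact: is_derive_continuous (is_derive_onem_powR (q - 1) t1).
- by move=> t _; exact: powR_ge0.
- move=> t; rewrite /= in_itv/= => /andP[t0 t1].
  rewrite mulNr normrN ger0_norm ?mulr_ge0 ?powR_ge0 ?invr_ge0 ?(ltW q0)//.
  by rewrite ger_pMr ?invr_gt0// powR_le1//; lra.
Qed.

Lemma powR_onem_powR (t p q : R) : t \in `]0, 1[ -> 0 < p -> 0 < q ->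
  t * (t `^ (p - 1)) = t `^ p /\ t `^ p <= 1 /\
  (1 - t) * ((1 - t) `^ (q - 1)) = (1 - t) `^ q /\ (1 - t) `^ q <= 1.
Proof.
rewrite in_itv/= => /andP[t0 t1] p0 q0.
split; first by rewrite mulr_powRB1 ?ltW.
split; first by rewrite powR_le1// !ltW.
split; first by rewrite mulr_powRB1 ?subr_ge0 ?ltW.
by rewrite powR_le1//; lra.
Qed.

(* Multiplying the weight by [t + (1 - t) = 1] bounds it by
   [t ^ (p - 1) + (1 - t) ^ (q - 1)]. *)
Lemma beta_integrable p q : 0 < p -> 0 < q ->
  mu.-integrable D (EFin \o beta_weight p q).
Proof.
move=> p0 q0; have mD : measurable D by exact: measurable_itv.
have ig : mu.-integrable D
    (EFin \o (fun t => t `^ (p - 1) + (1 - t) `^ (q - 1))).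
  have := integrableD mD (powR_integrable01 p0) (onem_powR_integrable01 q0).
  by apply: eq_integrable.
apply: (integrable_dominated mD _ ig (c := 1)).
  exact: measurable_beta_weight.
move=> t Dt; rewrite mul1r gtr0_norm ?beta_weight_gt0//.
have [h1 [h2 [h3 h4]]] := powR_onem_powR Dt p0 q0.
have := powR_ge0 t (p - 1); have := powR_ge0 (1 - t) (q - 1).
rewrite /beta_weight; set u := t `^ (p - 1) in h1 *.
by set v := (1 - t) `^ (q - 1) in h3 * => v0 u0; nra.
Qed.

Lemma Beta_gt0 p q : 0 < p -> 0 < q -> 0 < Beta p q.
Proof.
move=> p0 q0; apply: Rintegral_gt0.
- exact: measurable_itv.
- by rewrite lebesgue_measure_itv/= lte_fin ltr01 oppr0 adde0 lte_fin.
- by move=> t Dt; exact: beta_weight_gt0.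
- exact: beta_integrable.
Qed.

Lemma exhaust_left_powR (p : R) : 0 < p ->
  (exhaust_left n : R) `^ p @[n --> \oo] --> (0 : R).
Proof.
move=> p0; have /cvg_at_rightP := powR_cvg0 p0.
apply; split; first exact: exhaust_left_gt0.
exact: exhaust_left_cvg0.
Qed.

(** The function t^p (1 - t)^q tends to 0 at both ends of ]0, 1[, and its derivative is the weight
    of (p, q) multiplied by p - (p + q) t. *)
Lemma Beta_recursion p q : 0 < p -> 0 < q ->
  (p + q) * Beta (p + 1) q = p * Beta p q.
Proof.
move=> p0 q0; have mD : measurable D by exact: measurable_itv.
have p10 : 0 < p + 1 by rewrite addr_gt0.
have i1 := beta_integrable p0 q0; have i2 := beta_integrable p10 q0.
pose F (t : R) := t `^ p * (1 - t) `^ q.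
pose f (t : R) := p * beta_weight p q t - (p + q) * beta_weight (p + 1) q t.
have i1' : mu.-integrable D (EFin \o (fun t => p * beta_weight p q t)).
  by have := integrableZl mD p i1; apply: eq_integrable.
have i2' : mu.-integrable D
    (EFin \o (fun t => (p + q) * beta_weight (p + 1) q t)).
  by have := integrableZl mD (p + q) i2; apply: eq_integrable.
have if_ : mu.-integrable D (EFin \o f).
  by have := integrableB mD i1' i2'; apply: eq_integrable.
suff : \int[mu]_(t in D) f t = 0.
  rewrite /f RintegralB// !RintegralZl// => /eqP.
  by rewrite subr_eq0 => /eqP ->.
apply: (@improper_FTC R D exhaust_left (fun n => 1 - exhaust_left n) F f
    exhaust_lt (@exhaust_left_noninc R) exhaust_right_nondec itv01_exhaustion) => //.
- move=> t Dt; have [h1 [_ [h3 _]]] := powR_onem_powR Dt p0 q0.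
  move: Dt; rewrite /= in_itv/= => /andP[t0 t1].
  have := @is_deriveM R R (fun s : R => s `^ p) (fun s : R => (1 - s) `^ q)
    t 1 _ _ (is_derive1_powR p t0) (is_derive_onem_powR q t1).
  move/is_derive_eq; apply; rewrite /GRing.scale/= /f /beta_weight addrK.
  by rewrite -h3 -[t `^ p]h1; ring.
- move=> t; rewrite /= in_itv/= => /andP[t0 t1].
  have cw (a b : R) : {for t, continuous (beta_weight a b)}.
    apply: continuousM.
      exact: is_derive_continuous (is_derive1_powR (a - 1) t0).
    exact: is_derive_continuous (is_derive_onem_powR (b - 1) t1).
  by apply: continuousB; apply: continuousM => //; exact: cst_continuous.
have e1 : F (1 - exhaust_left n) @[n --> \oo] --> 0.
  apply: (squeeze_cvgr _ (cvg_cst 0) (exhaust_left_powR q0)).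
  apply: nearW => n; have Dt : (1 - exhaust_left n : R) \in `]0, 1[.
    by rewrite in_itv/=; have := @exhaust_left_le R n;
      have := @exhaust_left_gt0 R n; lra.
  have [_ [h2 _]] := powR_onem_powR Dt p0 q0.
  rewrite /F subKr mulr_ge0 ?powR_ge0//=.
  by rewrite ler_piMl ?powR_ge0.
have e2 : F (exhaust_left n) @[n --> \oo] --> 0.
  apply: (squeeze_cvgr _ (cvg_cst 0) (exhaust_left_powR p0)).
  apply: nearW => n; have Dt : (exhaust_left n : R) \in `]0, 1[.
    by rewrite in_itv/=; have := @exhaust_left_le R n;
      have := @exhaust_left_gt0 R n; lra.
  have [_ [_ [_ h4]]] := powR_onem_powR Dt p0 q0.
  by rewrite /F mulr_ge0 ?powR_ge0//= ler_piMr ?powR_ge0.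
by rewrite -(subrr 0); exact: cvgB.
Qed.

Lemma Beta_pochhammer p q n : 0 < p -> 0 < q ->
  Beta (p + n%:R) q = pochhammer p n / pochhammer (p + q) n * Beta p q.
Proof.
move=> p0 q0; elim: n => [|n IH].
  by rewrite /pochhammer !big_ord0 addr0 divr1 mul1r.
have pn0 : 0 < p + n%:R by rewrite ltr_wpDr.
have := Beta_recursion pn0 q0; rewrite IH => h.
have pqn : p + n%:R + q != 0 by rewrite gt_eqF// addr_gt0.
have -> : p + n.+1%:R = p + n%:R + 1 by rewrite -addrA -natr1.
apply: (mulfI pqn); rewrite h /pochhammer !big_ord_recr/=.
rewrite invfM -[p + q + _]addrA [q + _]addrC addrA.
by field; rewrite pqn/=; apply/prodf_neq0 => i _; rewrite gt_eqF// ltr_wpDr// addr_gt0.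
Qed.

End BetaIntegral.

(** * The binomial series and Euler's integral *)

Section UnitDisk.
Context {R : realType}.
Implicit Types (c : nat -> R).

(** Abel's form of a radius of convergence at least 1. Unlike summability at one given point, it
    passes to the derived series. *)
Definition radius_ge1 c :=
  forall rho, 0 < rho < 1 -> exists K, forall n, `|c n| * rho ^+ n <= K.

Lemma radius_ge1_bounded c K : (forall n, `|c n| <= K) -> radius_ge1 c.
Proof.
move=> cK rho /andP[r0 r1]; exists K => n; apply: le_trans (cK n).
by rewrite ler_piMr// exprn_ile1// ltW.
Qed.

(** Each of the n + 1 terms of 1 + q + ... + q^n is at least q^n, and their sum is (1 - q^(n + 1)) /
    (1 - q). *)
Lemma natr_expr_le (q : R) n : 0 < q < 1 -> n.+1%:R * q ^+ n <= (1 - q)^-1.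
Proof.
move=> /andP[q0 q1]; rewrite -[leRHS]mul1r ler_pdivlMr ?subr_gt0//.
suff : n.+1%:R * q ^+ n * (1 - q) <= 1 - q ^+ n.+1.
  by move/le_trans; apply; rewrite gerBl exprn_ge0// ltW.
elim: n => [|n IH]; first by rewrite expr0 expr1 !mul1r.
have qn : 0 <= q ^+ n by rewrite exprn_ge0// ltW.
have -> : n.+2%:R * q ^+ n.+1 * (1 - q) =
    q * (n.+1%:R * q ^+ n * (1 - q)) + q ^+ n.+1 * (1 - q).
  by rewrite -[n.+2]addn1 natrD exprS; ring.
have -> : 1 - q ^+ n.+2 =
  q * (1 - q ^+ n.+1) + q ^+ n.+1 * (1 - q) + (1 - q) * (1 - q ^+ n.+1).
  by rewrite exprS; ring.
have h1 : q * (n.+1%:R * q ^+ n * (1 - q)) <= q * (1 - q ^+ n.+1) by rewrite ler_pM2l.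
have h2 : 0 <= (1 - q) * (1 - q ^+ n.+1).
  by rewrite mulr_ge0 ?subr_ge0 ?exprn_ile1// ltW.
by lra.
Qed.

(** The factor n + 1 produced by derivation is absorbed by (rho / s)^n, for some s strictly between
    rho and 1. *)
Lemma radius_ge1_diffs c : radius_ge1 c -> radius_ge1 (pseries_diffs c).
Proof.
move=> rc rho /andP[r0 r1]; have [s [s0 rs s1]] : exists s, [/\ 0 < s, rho < s & s < 1].
  by exists ((1 + rho) / 2); split; lra.
have [|K HK] := rc s; first by rewrite s0.
exists (s^-1 * K * (1 - rho / s)^-1) => n.
have q01 : 0 < rho / s < 1 by rewrite divr_gt0//= ltr_pdivrMr// mul1r.
have -> : `|pseries_diffs c n| * rho ^+ n =
    s^-1 * (`|c n.+1| * s ^+ n.+1) * (n.+1%:R * (rho / s) ^+ n).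
  rewrite /pseries_diffs normrM normr_nat expr_div_n [s ^+ n.+1]exprS.
  have : s ^+ n != 0 by rewrite expf_neq0 ?gt_eqF.
  by move: (s ^+ n) => a a0; field; rewrite a0 gt_eqF.
apply: ler_pM; rewrite ?mulr_ge0 ?exprn_ge0 ?divr_ge0 ?invr_ge0 ?(ltW s0) ?(ltW r0)//.
  by rewrite ler_pM2l ?invr_gt0.
exact: natr_expr_le.
Qed.

Lemma radius_ge1_cvg c (y : R) : radius_ge1 c -> `|y| < 1 -> cvgn (pseries c y).
Proof.
move=> rc y1; have y0 := normr_ge0 y.
have [s [s0 ys s1]] : exists s, [/\ 0 < s, `|y| < s & s < 1].
  by exists ((1 + `|y|) / 2); split; lra.
have [|K HK] := rc s; first by rewrite s0.
apply: normed_cvg; apply: (@series_le_cvg _ _ (geometric K (`|y| / s))) => /=.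
- by [].
- move=> n; rewrite /geometric/= mulr_ge0 ?exprn_ge0 ?divr_ge0 ?(ltW s0)//.
  by apply: le_trans (HK 0%N); rewrite mulr_ge0 ?exprn_ge0 ?(ltW s0).
- move=> n; rewrite /geometric/= normrM normrX expr_div_n.
  rewrite mulrCA [leLHS]mulrC ler_wpM2l ?exprn_ge0// ler_pdivlMr ?exprn_gt0//.
- apply: is_cvg_geometric_series.
  by rewrite ger0_norm ?divr_ge0 ?(ltW s0)// ltr_pdivrMr// mul1r.
Qed.

Lemma radius_ge1_derive c (y : R) : radius_ge1 c -> `|y| < 1 ->
  is_derive y 1 (fun x => limn (pseries c x))
    (limn (pseries (pseries_diffs c) y)).
Proof.
move=> rc y1; have y0 := normr_ge0 y.
have K0 : 0 <= (1 + `|y|) / 2 by rewrite divr_ge0// addr_ge0.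
have K1 : `|(1 + `|y|) / 2| < 1 by rewrite ger0_norm//; lra.
apply: (@pseries_snd_diffs _ _ ((1 + `|y|) / 2)).
- exact: radius_ge1_cvg.
- by apply: radius_ge1_cvg => //; exact: radius_ge1_diffs.
- by apply: radius_ge1_cvg => //; do 2 apply: radius_ge1_diffs.
- by rewrite [ltRHS]ger0_norm//; lra.
Qed.

Lemma pseries_at0 c : limn (pseries c 0) = c 0%N.
Proof.
apply: cvg_lim => //; apply: cvg_near_cst; near=> n.
have n0 : (0 < n)%N by near: n; exact: nbhs_infty_gt.
rewrite -(prednK n0) /pseries/= /series/= big_nat_recl// expr0 mulr1.
by rewrite big1 ?addr0// => i _; rewrite expr0n mulr0.
Unshelve. all: by end_near. Qed.

End UnitDisk.

Section BinomialSeries.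
Context {R : realType}.
Variable A : R.
Hypothesis A0 : 0 < A.

(** The coefficient of y^n in (1 - y)^(- A), that is (-1)^n times the generalized binomial
    coefficient of - A. *)
Definition binomial_coef (n : nat) : R := pochhammer A n / n`!%:R.

Lemma pochhammer_gt0 (p : R) n : 0 < p -> 0 < pochhammer p n.
Proof. by move=> p0; apply: prodr_gt0 => i _; rewrite ltr_wpDr. Qed.

Lemma binomial_coef_gt0 n : 0 < binomial_coef n.
Proof. by rewrite divr_gt0 ?pochhammer_gt0// ltr0n fact_gt0. Qed.

Lemma binomial_coef_rec n :
  n.+1%:R * binomial_coef n.+1 = (A + n%:R) * binomial_coef n.
Proof.
rewrite /binomial_coef /pochhammer big_ord_recr/= factS natrM invfM.
rewrite [LHS]mulrCA -!mulrA; rewrite [X in _ * (_ * X)]mulVKf ?pnatr_eq0//.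
by rewrite mulrCA.
Qed.

(** Consecutive terms have ratio (A + n) rho / (n + 1), at most 1 once n >= A rho / (1 - rho). The
    terms decrease from rank [N] on, and the sum of those up to [N] bounds them all. *)
Lemma radius_binomial : radius_ge1 binomial_coef.
Proof.
move=> rho /andP[r0 r1]; pose u n := binomial_coef n * rho ^+ n.
pose N := Num.bound (A * rho / (1 - rho)).
have u0 n : 0 <= u n by rewrite mulr_ge0 ?ltW ?binomial_coef_gt0// exprn_gt0.
have dec n : (N <= n)%N -> u n.+1 <= u n.
  move=> Nn.
  have n1 : 0 < n.+1%:R :> R by [].
  rewrite -(ler_pM2l n1) /u mulrA binomial_coef_rec exprS.
  have -> : (A + n%:R) * binomial_coef n * (rho * rho ^+ n) =
    (A + n%:R) * rho * (binomial_coef n * rho ^+ n) by ring.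
  rewrite ler_wpM2r//; first exact: u0.
  have : A * rho / (1 - rho) < n%:R.
    apply: (@lt_le_trans _ _ N%:R); last by rewrite ler_nat.
    by apply: archi_boundP; rewrite divr_ge0 ?mulr_ge0 ?subr_ge0 ?ltW.
  by rewrite ltr_pdivrMr ?subr_gt0// -natr1; lra.
exists (\sum_(k < N.+1) u k) => n; rewrite gtr0_norm ?binomial_coef_gt0//.
rewrite -/(u n); have small k : (k <= N)%N -> u k <= \sum_(k < N.+1) u k.
  by move=> kN; rewrite (bigD1 (Ordinal (kN : (k < N.+1)%N)))//= lerDl sumr_ge0.
have [/small//|/ltnW Nn] := leqP n N.
rewrite -(subnKC Nn); elim: (n - N)%N => [|k IH]; first by rewrite addn0 small.
by rewrite addnS; apply: le_trans (dec _ _) IH; rewrite leq_addr.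
Qed.

Let f y := limn (pseries binomial_coef y).
Let f' y := limn (pseries (pseries_diffs binomial_coef) y).

Lemma binomial_ode y : `|y| < 1 -> (1 - y) * f' y = A * f y.
Proof.
move=> y1; have c1 := radius_ge1_cvg radius_binomial y1.
have c2 := radius_ge1_cvg (radius_ge1_diffs radius_binomial) y1.
have c3 := pseries_diffs_equiv c2.
(* The recurrence on the coefficients, read termwise, is f' = A f + y f'. *)
have E : pseries (pseries_diffs binomial_coef) y = (fun n =>
    A * pseries binomial_coef y n +
    y * series (fun i => i%:R * binomial_coef i * y ^+ i.-1) n).
  apply/funext => n; rewrite /pseries/= /series/= !mulr_sumr -big_split/=.
  apply: eq_bigr => -[|i] _ /=.
    by rewrite /pseries_diffs binomial_coef_rec !expr0; ring.
  by rewrite /pseries_diffs binomial_coef_rec exprS; ring.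
have : pseries (pseries_diffs binomial_coef) y @ \oo --> A * f y + y * f' y.
  by rewrite E; apply: cvgD; apply: cvgMr.
move/cvg_lim => /(_ (@Rhausdorff R)) h.
by rewrite mulrBl mul1r {1}/f' h; ring.
Qed.

(** By the differential equation f(z) (1 - z)^A has derivative 0, and its value at 0 is 1. *)
Lemma binomial_series y : 0 <= y < 1 -> f y = (1 - y) `^ (- A).
Proof.
move=> /andP[y0 y1].
pose g z := f z * (1 - z) `^ A.
have dg (z : R) : -1 < z < 1 -> is_derive z 1 g 0.
  move=> /andP[z1 z2]; have z3 : `|z| < 1 by rewrite ltr_norml z1.
  have := @is_deriveM R R _ (fun s : R => (1 - s) `^ A) z 1 _ _
    (radius_ge1_derive radius_binomial z3) (is_derive_onem_powR A z2).
  move/is_derive_eq; apply; rewrite /GRing.scale/= -/(f z) -/(f' z).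
  have z4 : 0 <= 1 - z by rewrite subr_ge0 ltW.
  rewrite -(mulr_powRB1 z4 A0).
  have -> : f z * - (A * (1 - z) `^ (A - 1)) + (1 - z) * (1 - z) `^ (A - 1) * f' z
    = (1 - z) `^ (A - 1) * ((1 - z) * f' z - A * f z) by ring.
  by rewrite binomial_ode// subrr mulr0.
have g0 : g 0 = 1.
  rewrite /g /f pseries_at0 subr0 powR1 mulr1.
  by rewrite /binomial_coef /pochhammer big_ord0 fact0 divr1.
have : g y = 1.
  have [x||c _] := @MVT_segment R g (cst 0) 0 y y0.
  - by rewrite in_itv/= => /andP[x0 xy]; apply: dg; lra.
  - apply: continuous_in_subspaceT => x; rewrite inE/= in_itv/= => /andP[x0 xy].
    by apply: is_derive_continuous (dg _ _); lra.
  by rewrite /= mul0r g0 => /eqP; rewrite subr_eq0 => /eqP.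
have p0 : 0 < (1 - y) `^ A by apply: powR_gt0; rewrite subr_gt0.
rewrite /g powRN => gy; apply: (mulIf (lt0r_neq0 p0)).
by rewrite gy mulVf// lt0r_neq0.
Qed.

Lemma binomial_series_cvg y : 0 <= y < 1 ->
  series (fun n => binomial_coef n * y ^+ n) @ \oo --> (1 - y) `^ (- A).
Proof.
move=> y01; rewrite -binomial_series//.
by apply: radius_ge1_cvg; [exact: radius_binomial|rewrite ger0_norm; lra].
Qed.

End BinomialSeries.

Section EulerIntegral.
Context {R : realType}.
Local Notation mu := (@lebesgue_measure R).
Local Notation D := (`]0, 1[%classic : set (measurableTypeR R)).
Variables (p q A x : R).
Hypotheses (p0 : 0 < p) (q0 : 0 < q) (A0 : 0 < A) (x01 : 0 <= x <= 1).

Definition euler_weight (t : R) : R := beta_weight p q t * (1 - x * t) `^ (- A).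
Definition euler_integral : R := \int[mu]_(t in D) euler_weight t.

(** At x = 1 the weight behaves like (1 - t)^(q - A - 1) near t = 1, so positivity of p, q and A
    does not ensure integrability. *)
Hypothesis ie : mu.-integrable D (EFin \o euler_weight).

(** All terms are nonnegative, so sum and integral are exchanged by monotone convergence, which asks
    for no uniformity and so includes x = 1. Finiteness of the integral then yields convergence of
    the numerical series. *)
Lemma euler_series :
  series (fun n => binomial_coef A n * x ^+ n * Beta (p + n%:R) q) @ \oo -->
  euler_integral.
Proof.
have mD : measurable D by exact: measurable_itv.
have x0 : 0 <= x by case/andP: x01.
pose u n t := (binomial_coef A n * x ^+ n * beta_weight (p + n%:R) q t)%:E.
have pn0 n : 0 < p + n%:R by rewrite ltr_wpDr.
have bx n : 0 <= binomial_coef A n * x ^+ n.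
  by rewrite mulr_ge0 ?exprn_ge0// ltW ?binomial_coef_gt0.
have mu_ n : measurable_fun D (u n).
  apply/measurable_EFinP; apply: measurable_funM => //.
  exact: measurable_beta_weight.
have u0 n t : D t -> (0 <= u n t)%E.
  by move=> Dt; rewrite lee_fin mulr_ge0// ltW// beta_weight_gt0.
have := integral_nneseries mu mD mu_ u0.
have -> : (\int[mu]_(t in D) (\sum_(n <oo) u n t))%E = (euler_integral)%:E.
  rewrite /euler_integral /Rintegral fineK; last exact: integrable_fin_num.
  apply: eq_integral => t; rewrite inE => Dt.
  have t01 : 0 < t < 1 by move: Dt; rewrite /= in_itv.
  have t0 : 0 < t by case/andP: t01.
  apply: cvg_lim => //.
  have -> : (fun n => \sum_(0 <= i < n) u i t)%E =
    (fun n => (beta_weight p q t *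
       series (fun n => binomial_coef A n * (x * t) ^+ n) n)%:E).
    apply/funext => n; rewrite sumEFin /series/= mulr_sumr; congr EFin.
    apply: eq_bigr => i _; rewrite /beta_weight exprMn -(@powR_mulrn _ t) ?(ltW t0)//.
    have -> : p + i%:R - 1 = p - 1 + i%:R by ring.
    by rewrite powRD ?(gt_eqF t0) ?implybT//; ring.
  apply/cvg_EFin; first exact: nearW.
  apply: cvgMr; apply: binomial_series_cvg => //.
  by case/andP: x01 => _ x1; rewrite mulr_ge0 ?(ltW t0)//=; nra.
have Bn n : (\int[mu]_(t in D) u n t)%E =
    (binomial_coef A n * x ^+ n * Beta (p + n%:R) q)%:E.
  have ib := beta_integrable (pn0 n) q0.
  rewrite /Beta -RintegralZl// /Rintegral fineK//.
  apply: integrable_fin_num => //.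
  by have := integrableZl mD (binomial_coef A n * x ^+ n) ib; apply: eq_integrable.
move=> E; have := @is_cvg_nneseries R
  (fun n => (binomial_coef A n * x ^+ n * Beta (p + n%:R) q)%:E) xpredT 0%N.
have B0 n : 0 <= binomial_coef A n * x ^+ n * Beta (p + n%:R) q.
  by rewrite mulr_ge0// ltW// Beta_gt0.
move=> /(_ (fun n _ _ => B0 n)) C.
have {}C : (fun n => (series (fun n => binomial_coef A n * x ^+ n *
    Beta (p + n%:R) q) n)%:E) @ \oo --> (euler_integral)%:E.
  rewrite E; rewrite (eq_eseriesr (fun n _ => Bn n)).
  by move: C; rewrite (_ : (fun n => _) = (fun n => (series (fun n =>
    binomial_coef A n * x ^+ n * Beta (p + n%:R) q) n)%:E))//;
    apply/funext => n; rewrite sumEFin.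
by move/fine_cvgP : C => [].
Qed.

(** Convergence is recorded beside the value: at x = 1 it is the summability of the coefficients,
    needed for continuity up to that endpoint. *)
Lemma hyp2F1_cvg : series (fun n => pochhammer A n * pochhammer p n /
    (pochhammer (p + q) n * n`!%:R) * x ^+ n) @ \oo -->
  euler_integral / Beta p q.
Proof.
pose v n := series (fun n => binomial_coef A n * x ^+ n *
  Beta (p + n%:R) q) n * (Beta p q)^-1.
have h : v @ \oo --> euler_integral / Beta p q.
  by apply: cvgM; [exact: euler_series|exact: cvg_cst].
apply: cvg_trans h; apply: near_eq_cvg; apply: nearW => n; rewrite /v.
rewrite /series/= mulr_suml; apply: eq_bigr => i _.
rewrite Beta_pochhammer// /binomial_coef.
have b0 := Beta_gt0 p0 q0.
have pq := pochhammer_gt0 i (addr_gt0 p0 q0).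
field; rewrite !gt_eqF//= ltr0n fact_gt0.
Qed.

Lemma hyp2F1_euler : hyp2F1 A p (p + q) x = euler_integral / Beta p q.
Proof. by apply: cvg_lim => //; exact: hyp2F1_cvg. Qed.

End EulerIntegral.

(** * The Gamma function and Euler's integral as Laplace transforms *)

Lemma powR_expR_ln (R : realType) (t p : R) : 0 < t -> t `^ p = expR (p * ln t).
Proof. by move=> t0; rewrite /powR gt_eqF. Qed.

Lemma sum_ord3 (R : realType) (F : 'I_3 -> R) : \sum_i F i = F 0 + F 1 + F 2.
Proof.
rewrite !big_ord_recl big_ord0 addr0 addrA.
by congr (_ + _ + _); congr F; apply/val_inj.
Qed.

Section GammaSmooth.
Context {R : realType} (h : R) (c : 'I_3 -> R).
Local Notation mu := (@lebesgue_measure R).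

Definition gamma_domain : set (measurableTypeR R) := `]0, +oo[%classic.
(** The part t^(- h - 1) exp (- t) of the Gamma integrand that does not depend on y. The linear form
    with coefficients [c] gives the rest, so that one construction covers the four Gamma factors. *)
Definition gamma_base (t : measurableTypeR R) : R :=
  expR (- (h + 1) * ln t - t).
Definition gamma_log (i : 'I_3) (t : measurableTypeR R) : R := c i * ln t.
Definition gamma_form (y : 'rV[R]_3) : R := \sum_i y 0 i * c i.

Lemma measurable_gamma_domain : measurable gamma_domain.
Proof. exact: measurable_itv. Qed.

Lemma measurable_gamma_base : measurable_fun gamma_domain gamma_base.
Proof.
apply: measurableT_comp => //; apply: measurable_funB => //.
apply: measurable_funM => //.
by apply: (@measurable_funS _ _ _ _ setT) => //; exact: measurable_ln.
Qed.

Lemma measurable_gamma_log i : measurable_fun gamma_domain (gamma_log i).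
Proof.
apply: measurable_funM => //.
by apply: (@measurable_funS _ _ _ _ setT) => //; exact: measurable_ln.
Qed.

Lemma gamma_base_ge0 t : gamma_domain t -> 0 <= gamma_base t.
Proof. by move=> _; exact: expR_ge0. Qed.

Lemma gamma_exponent (y : 'rV[R]_3) t :
  laplace_exponent gamma_log y t = gamma_form y * ln t.
Proof.
by rewrite /laplace_exponent mulr_suml; apply: eq_bigr => i _; rewrite mulrA.
Qed.

(** The margin multiplies the integrand by exp (k |ln t|) <= t^k + t^(- k). Two Gamma integrands
    with arguments shifted by k and - k thus dominate, and both arguments stay positive when k <
    gamma_form y - h. *)
Lemma gamma_dominated (y : 'rV[R]_3) : h < gamma_form y ->
  laplace_dominated gamma_domain gamma_base gamma_log y.
Proof.
move=> hy; pose N := \sum_i `|c i|.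
have N0 : 0 <= N by exact: sumr_ge0.
(* Makes k = e N smaller than [gamma_form y - h]; the added 1 avoids a division by 0 when N = 0. *)
pose e := (gamma_form y - h) / (N + 1) / 2.
have e0 : 0 < e by rewrite !divr_gt0// ?subr_gt0// ltr_wpDl.
have eN : e * N < gamma_form y - h.
  have : e * (N + 1) * 2 = gamma_form y - h.
    by rewrite /e; field; rewrite gt_eqF// ltr_wpDl.
  have : 0 <= e * N by rewrite mulr_ge0// ltW.
  by lra.
set k := e * N in eN; have k0 : 0 <= k by rewrite mulr_ge0// ltW.
exists e => //.
pose g (s t : R) := t `^ (gamma_form y - h + s - 1) * expR (- t).
have ig s : `|s| <= k -> mu.-integrable gamma_domain (EFin \o g s).
  by move=> sk; apply: Gamma_integrable; have := ler_norm (- s); rewrite normrN; lra.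
have ig2 : mu.-integrable gamma_domain (EFin \o (fun t => g k t + g (- k) t)).
  have := integrableD measurable_gamma_domain (ig k _) (ig (- k) _).
  rewrite normrN ger0_norm// lexx => /(_ isT isT).
  by apply: eq_integrable => //; exact: measurable_gamma_domain.
apply: (integrable_dominated measurable_gamma_domain _ ig2 (c := 1)).
  apply: measurable_funM; first exact: measurable_gamma_base.
  apply: measurableT_comp => //; apply: measurable_funD.
    by apply: measurable_laplace_exponent => i; exact: measurable_gamma_log.
  apply: measurable_funM => //.
  by apply: measurable_laplace_norm => i; exact: measurable_gamma_log.
move=> t; rewrite /gamma_domain/= in_itv/= andbT => t0; rewrite mul1r.
rewrite ger0_norm ?mulr_ge0 ?expR_ge0// gamma_exponent.
have -> : laplace_norm gamma_log t = N * `|ln t|.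
  by rewrite /laplace_norm mulr_suml; apply: eq_bigr => i _; rewrite normrM.
rewrite /g !powR_expR_ln// /gamma_base -!expRD mulrA -/k.
have [l0|l0] := leP 0 (ln t).
  rewrite ger0_norm//; apply: le_trans
    (_ : _ <= expR ((gamma_form y - h + k - 1) * ln t - t)) _.
    by rewrite ler_expR; lra.
  by rewrite lerDl expR_ge0.
rewrite ltr0_norm//; apply: le_trans
  (_ : _ <= expR ((gamma_form y - h - k - 1) * ln t - t)) _.
  by rewrite ler_expR; lra.
by rewrite lerDr expR_ge0.
Qed.

Lemma gamma_momentE (y : 'rV[R]_3) :
  laplace_moment gamma_domain gamma_base gamma_log [::] y = Gamma (gamma_form y - h).
Proof.
apply: eq_Rintegral => t; rewrite inE /gamma_domain/= in_itv/= andbT => t0.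
rewrite big_nil mulr1 gamma_exponent powR_expR_ln// /gamma_base -!expRD.
by congr expR; ring.
Qed.

End GammaSmooth.

Section EulerSmooth.
Context {R : realType} (h x : R).
Hypothesis x01 : 0 <= x <= 1.
Local Notation mu := (@lebesgue_measure R).

Definition euler_domain : set (measurableTypeR R) := `]0, 1[%classic.
Definition euler_base (t : measurableTypeR R) : R :=
  expR (- ln t - (h + 1) * ln (1 - t)).
(** The coefficients of alpha, beta and gamma, in this order, in the logarithm of the Euler
    integrand; [euler_base] is the remaining factor t^(-1) (1 - t)^(- h - 1). *)
Definition euler_log (i : 'I_3) (t : measurableTypeR R) : R :=
  [:: ln (1 - x * t) - ln t; ln (1 - t) - ln (1 - x * t); ln t]`_i.

Lemma measurable_euler_domain : measurable euler_domain.
Proof. exact: measurable_itv. Qed.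

Let measurable_ln_comp (f : measurableTypeR R -> R) :
  measurable_fun euler_domain f -> measurable_fun euler_domain (fun t => ln (f t)).
Proof. by move=> mf; apply: (measurableT_comp (@measurable_ln R)). Qed.

Lemma measurable_euler_base : measurable_fun euler_domain euler_base.
Proof.
apply: measurableT_comp => //; apply: measurable_funB.
  by apply: measurable_funN; exact: measurable_ln_comp.
by apply: measurable_funM => //; apply: measurable_ln_comp; exact: measurable_funB.
Qed.

Lemma measurable_euler_log i : measurable_fun euler_domain (euler_log i).
Proof.
have m1 : measurable_fun euler_domain (fun t => ln (1 - x * t)).
  by apply: measurable_ln_comp; apply: measurable_funB => //; exact: measurable_funM.
have m2 : measurable_fun euler_domain (fun t => ln (1 - t)).
  by apply: measurable_ln_comp; exact: measurable_funB.
have m3 : measurable_fun euler_domain (fun t => ln t) by exact: measurable_ln_comp.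
case: i => -[|[|[|//]]] /= i3; rewrite /euler_log/=; last exact: m3.
  exact: measurable_funB.
exact: measurable_funB.
Qed.

Lemma euler_base_ge0 t : euler_domain t -> 0 <= euler_base t.
Proof. by move=> _; exact: expR_ge0. Qed.

Lemma euler_exponent (y : 'rV[R]_3) t : laplace_exponent euler_log y t =
  (y 0 2 - y 0 0) * ln t + y 0 1 * ln (1 - t) + (y 0 0 - y 0 1) * ln (1 - x * t).
Proof. by rewrite /laplace_exponent sum_ord3 /euler_log/=; ring. Qed.

(* All the logarithms are nonpositive and [1 - t <= 1 - x * t], so that a Beta
   weight with slightly smaller exponents dominates, uniformly in [x]. *)
Lemma euler_dominated (y : 'rV[R]_3) : h < y 0 0 -> y 0 0 < y 0 1 -> y 0 0 < y 0 2 ->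
  laplace_dominated euler_domain euler_base euler_log y.
Proof.
move=> h0 h1 h2.
(* The margin costs at most a factor t^(- 2 e) (1 - t)^(- 3 e); a quarter of the smaller gap keeps
   both Beta parameters positive. *)
have [e [e0 e1 e2]] : exists e, [/\ 0 < e, 0 < y 0 2 - y 0 0 - 2 * e &
    0 < y 0 0 - h - 3 * e].
  exists (Num.min (y 0 2 - y 0 0) (y 0 0 - h) / 4).
  set m := Num.min _ _.
  have m0 : 0 < m by rewrite lt_min !subr_gt0 h0 h2.
  have m1 : m <= y 0 2 - y 0 0 by rewrite ge_min lexx.
  have m2 : m <= y 0 0 - h by rewrite ge_min lexx orbT.
  split; lra.
exists e => //.
have ib := beta_integrable e1 e2.
apply: (integrable_dominated measurable_euler_domain _ ib (c := 1)).
  apply: measurable_funM; first exact: measurable_euler_base.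
  apply: measurableT_comp => //; apply: measurable_funD.
    by apply: measurable_laplace_exponent => i; exact: measurable_euler_log.
  apply: measurable_funM => //.
  by apply: measurable_laplace_norm => i; exact: measurable_euler_log.
move=> t; rewrite /euler_domain/= in_itv/= => /andP[t0 t1]; rewrite mul1r.
rewrite ger0_norm ?mulr_ge0 ?expR_ge0// euler_exponent.
rewrite /laplace_norm sum_ord3 /euler_log/= /beta_weight.
have t1' : 0 < 1 - t by rewrite subr_gt0.
rewrite !powR_expR_ln// /euler_base -!expRD ler_expR.
have /andP[x0 x1] := x01.
have b0 : ln t <= 0 by rewrite ln_le0// ltW.
have xt : 1 - t <= 1 - x * t by nra.
have c0 : ln (1 - x * t) <= 0 by rewrite ln_le0//; nra.
have c1 : ln (1 - t) <= ln (1 - x * t).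
  by rewrite ler_ln ?posrE//; exact: lt_le_trans xt.
move: (ln t) (ln (1 - t)) (ln (1 - x * t)) b0 c0 c1 => u v z u0 z0 vz.
rewrite (ler0_norm u0) (ler0_norm (_ : v - z <= 0)) ?subr_le0//.
have n1 : `|z - u| <= - z - u.
  by apply: le_trans (ler_normB _ _) _; rewrite (ler0_norm u0) (ler0_norm z0).
have n2 : e * (`|z - u| + - (v - z) + - u) <= e * (- 2 * u - 3 * v).
  by rewrite ler_pM2l//; lra.
have n3 : (y 0 0 - y 0 1) * z <= (y 0 0 - y 0 1) * v by nra.
by lra.
Qed.

Lemma euler_integrand (y : 'rV[R]_3) t : euler_domain t ->
  euler_base t * \prod_(i <- [::]) euler_log i t *
    expR (laplace_exponent euler_log y t) =
  euler_weight (y 0 2 - y 0 0) (y 0 1 - h) (y 0 1 - y 0 0) x t.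
Proof.
rewrite /euler_domain/= in_itv/= => /andP[t0 t1].
rewrite big_nil mulr1 euler_exponent /euler_weight /beta_weight.
have t1' : 0 < 1 - t by rewrite subr_gt0.
have xt : 0 < 1 - x * t by have /andP[x0 x1] := x01; nra.
rewrite !powR_expR_ln// /euler_base -!expRD.
by congr expR; ring.
Qed.

Lemma euler_momentE (y : 'rV[R]_3) :
  laplace_moment euler_domain euler_base euler_log [::] y =
  euler_integral (y 0 2 - y 0 0) (y 0 1 - h) (y 0 1 - y 0 0) x.
Proof. by apply: eq_Rintegral => t; rewrite inE => /euler_integrand. Qed.

Lemma euler_integrable (y : 'rV[R]_3) : h < y 0 0 -> y 0 0 < y 0 1 ->
  y 0 0 < y 0 2 -> mu.-integrable euler_domain
    (EFin \o euler_weight (y 0 2 - y 0 0) (y 0 1 - h) (y 0 1 - y 0 0) x).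
Proof.
move=> h0 h1 h2; have := laplace_integrable measurable_euler_domain
  measurable_euler_base measurable_euler_log euler_base_ge0 [::]
  (euler_dominated h0 h1 h2).
apply: eq_integrable; first exact: measurable_euler_domain.
by move=> t; rewrite inE => /euler_integrand /= ->.
Qed.

End EulerSmooth.

(** * Powers and power series *)

Section SmoothClosureExamples.
Context {R : realType} {V : normedModType R}.
Variables (U : set V) (S : set (V -> R)).
Implicit Types f g : V -> R.

Lemma sc_expR f : smooth_closure U S f ->
  smooth_closure U S (fun x => expR (f x)).
Proof.
move=> sf; apply: (@sc_comp _ _ U S (fun _ => @expR R) 0%N f) => //.
Qed.

Lemma sc_powR f p : (forall x, U x -> 0 < f x) -> smooth_closure U S f ->
  smooth_closure U S (fun x => f x `^ p).
Proof.
move=> f0 sf.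
pose u n (y : R) := \prod_(i < n) (p - i%:R) * y `^ (p - n%:R).
have -> : (fun x => f x `^ p) = (fun x => u 0%N (f x)).
  by apply/funext => x; rewrite /u big_ord0 mul1r subr0.
apply: sc_comp => // x Ux n.
have := @is_deriveZ R R R (fun s : R => s `^ (p - n%:R))
  (\prod_(i < n) (p - i%:R)) (f x) 1 _ (is_derive1_powR (p - n%:R) (f0 x Ux)).
move/is_derive_eq; apply; rewrite /u big_ord_recr/= /GRing.scale/= mulrA.
by congr (_ * _ `^ _); rewrite -natr1; ring.
Qed.

Lemma sc_pseries (c : nat -> R) f : radius_ge1 c ->
  (forall x, U x -> `|f x| < 1) -> smooth_closure U S f ->
  smooth_closure U S (fun x => limn (pseries c (f x))).
Proof.
move=> rc f1 sf; pose u n (y : R) := limn (pseries (iter n (@pseries_diffs R) c) y).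
apply: (@sc_comp _ _ U S u 0%N f) => // x Ux n.
apply: radius_ge1_derive; last exact: f1.
by elim: n => //= n; exact: radius_ge1_diffs.
Qed.

End SmoothClosureExamples.

Section RealVariable.
Context {R : realType}.
Implicit Types (I : interval R) (f g : R -> R).

Lemma derivation_stable_id (U : set R) : derivation_stable U [set 1] [set id].
Proof.
move=> f /= ->; split=> [x _|v ->]; first exact: cvg_id.
by exists (cst 1); [exact: sc_cst|move=> x _; exact: is_derive_id].
Qed.

Lemma smooth_itv_ext I f g : open [set` I] -> (forall x, x \in I -> f x = g x) ->
  smooth_itv I f -> smooth_itv I g.
Proof.
move=> oI fg sf.
have H n x : x \in I -> derive1n n f x = derive1n n g x.
  elim: n x => [|n IH] x xI; first exact: fg.
  rewrite !derive1nS !derive1E; apply: near_eq_derive.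
  by apply: near_open oI xI _ => y yI; exact: IH.
move=> n x xI; apply: near_eq_derivable (sf n x xI).
by apply: near_open oI xI _ => y yI; exact: H.
Qed.

Lemma smooth_itv_cst I (k : R) : open [set` I] -> smooth_itv I (cst k).
Proof.
move=> oI; apply: (smooth_closure_itv oI (@derivation_stable_id _)).
exact: sc_cst.
Qed.

Lemma smooth_itv_continuous I f : smooth_itv I f -> {within [set` I], continuous f}.
Proof.
by move=> sf; apply: derivable_within_continuous => x xI; exact: (sf 0%N).
Qed.

(** Where X vanishes the power need not be differentiable; monotonicity replaces the derivative
    there, since X s <= eps^(1/p) gives (X s)^p <= eps. *)
Lemma powR_continuous_comp (X : R -> R) (p : R) : 0 < p -> continuous X ->
  (forall r, 0 <= X r) -> continuous (fun r => X r `^ p).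
Proof.
move=> p0 cX X0 r; have [Xr0|Xr] := eqVneq (X r) 0; last first.
  have Xr0 : 0 < X r by rewrite lt_neqAle eq_sym Xr X0.
  apply: (@continuous_comp _ _ _ X (fun y => y `^ p)); first exact: cX.
  exact: is_derive_continuous (is_derive1_powR p Xr0).
apply/cvgrPdist_le => e e0; rewrite Xr0 powR0 ?gt_eqF//.
near=> s; rewrite sub0r normrN ger0_norm ?powR_ge0//.
have -> : e = (e `^ p^-1) `^ p by rewrite -powRrM mulVf ?gt_eqF// powRr1// ltW.
apply: ge0_ler_powR; rewrite ?nnegrE ?powR_ge0 ?X0 ?(ltW p0)//.
have : `|X r - X s| <= e `^ p^-1.
  by near: s; move/cvgrPdist_le : (cX r); apply; rewrite powR_gt0.
by rewrite Xr0 sub0r normrN ger0_norm.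
Unshelve. all: by end_near. Qed.

(** Weierstrass's test: on [0, 1] the tails are bounded by those of the series of [c]. Composing
    with an X confined to [0, 1] takes the place of one-sided continuity at 1, beyond which the
    series may diverge. *)
Lemma pseries_continuous_closed (c : nat -> R) (X : R -> R) :
  (forall n, 0 <= c n) -> cvgn (series c) -> continuous X ->
  (forall r, 0 <= X r <= 1) -> continuous (fun r => limn (pseries c (X r))).
Proof.
move=> c0 cc cX X01 r.
have term y n : 0 <= y <= 1 -> 0 <= c n * y ^+ n <= c n.
  move=> /andP[y0 y1]; rewrite mulr_ge0 ?exprn_ge0//=.
  by rewrite ler_piMr// exprn_ile1.
have cvgp y : 0 <= y <= 1 -> cvgn (pseries c y).
  move=> y01; apply: (@series_le_cvg _ _ c) => // n.
    by case/andP: (term y n y01).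
  by case/andP: (term y n y01).
have tail y N : 0 <= y <= 1 ->
    `|limn (pseries c y) - pseries c y N| <= limn (series c) - series c N.
  move=> y01; have diff n : (N <= n)%N ->
      `|pseries c y n - pseries c y N| <= series c n - series c N.
    move=> Nn; rewrite /pseries/= !sub_series_geq// ger0_norm.
      by apply: ler_sum => i _; case/andP: (term y i y01).
    by apply: sumr_ge0 => i _; case/andP: (term y i y01).
  have l1 : (fun n => `|pseries c y n - pseries c y N|) @ \oo -->
      `|limn (pseries c y) - pseries c y N|.
    by apply: cvg_norm; apply: cvgB; [exact: cvgp|exact: cvg_cst].
  have l2 : (fun n => series c n - series c N) @ \oo -->
      limn (series c) - series c N.
    by apply: cvgB => //; exact: cvg_cst.
  apply: ler_cvg_to l1 l2 _.
  by near=> n; apply: diff; near: n; exact: nbhs_infty_ge.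
apply/cvgrPdist_le => e e0.
have [N HN] : exists N, limn (series c) - series c N <= e / 3.
  move/cvgrPdist_le : cc => /(_ (e / 3)); rewrite divr_gt0// => /(_ isT)[N _ HN].
  by exists N; apply: le_trans (HN N _) => //=; exact: ler_norm.
have cS : continuous (fun r => pseries c (X r) N).
  rewrite /pseries/= /series/=; elim: N {HN} => [|N IH].
    by under eq_fun do rewrite big_nil; exact: cst_continuous.
  under eq_fun do rewrite big_nat_recr//=.
  move=> s; have cN : {for s, continuous (fun r => c N * X r ^+ N)}.
    apply: continuousM; first exact: cst_continuous.
    by apply: (@continuous_comp _ _ _ X (fun y => y ^+ N));
      [exact: cX|exact: exprn_continuous].
  exact: continuousD (IH s) cN.
near=> s.
have h1 := tail (X r) N (X01 r); have h2 := tail (X s) N (X01 s).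
have h3 : `|pseries c (X r) N - pseries c (X s) N| <= e / 3.
  by near: s; move/cvgrPdist_le : (cS r); apply; rewrite divr_gt0.
have -> : limn (pseries c (X r)) - limn (pseries c (X s)) =
    (limn (pseries c (X r)) - pseries c (X r) N) +
    (pseries c (X r) N - pseries c (X s) N) -
    (limn (pseries c (X s)) - pseries c (X s) N) by ring.
apply: le_trans (ler_normB _ _) _; apply: le_trans (lerD (ler_normD _ _) (lexx _)) _.
by lra.
Unshelve. all: by end_near. Qed.

End RealVariable.

(** * Dependence on the parameters *)

Section ParameterSpace.
Context {R : realType} (h : R).
Implicit Types y : 'rV[R]_3.

Definition param_nbhd : set 'rV[R]_3 :=
  [set y | [/\ h < y 0 0, y 0 0 < y 0 1 & y 0 0 < y 0 2]].

Lemma open_coord_lt (i j : 'I_3) : open [set y : 'rV[R]_3 | y 0 i < y 0 j].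
Proof.
have -> : [set y : 'rV[R]_3 | y 0 i < y 0 j] =
    (fun y : 'rV[R]_3 => y 0 j - y 0 i) @^-1` `]0, +oo[%classic.
  by apply/seteqP; split=> y /=; rewrite in_itv/= andbT subr_gt0.
apply: open_comp => [y _|]; last exact: interval_open.
by apply: continuousB; exact: coord_continuous.
Qed.

Lemma open_param_nbhd : open param_nbhd.
Proof.
have o1 : open [set y : 'rV[R]_3 | h < y 0 0].
  have -> : [set y : 'rV[R]_3 | h < y 0 0] =
      (fun y : 'rV[R]_3 => y 0 0) @^-1` `]h, +oo[%classic.
    by apply/seteqP; split=> y /=; rewrite in_itv/= andbT.
  apply: open_comp => [y _|]; last exact: interval_open.
  exact: coord_continuous.
have -> : param_nbhd = [set y : 'rV[R]_3 | h < y 0 0] `&`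
    ([set y : 'rV[R]_3 | y 0 0 < y 0 1] `&` [set y : 'rV[R]_3 | y 0 0 < y 0 2]).
  by apply/seteqP; split=> [y [? ? ?]|y [? [? ?]]].
by apply: openI => //; apply: openI; exact: open_coord_lt.
Qed.

Inductive param_base : ('rV[R]_3 -> R) -> Prop :=
| pb_coord i : param_base (fun y => y 0 i)
| pb_gamma c s : (forall y, param_nbhd y -> h < gamma_form c y) ->
    param_base (laplace_moment gamma_domain (gamma_base h) (gamma_log c) s)
| pb_euler x s : 0 <= x <= 1 ->
    param_base (laplace_moment euler_domain (euler_base h) (euler_log x) s).

Lemma param_base_stable :
  derivation_stable param_nbhd (range (@delta_mx R 1 3 0)) param_base.
Proof.
move=> f [i|c s hc|x s x01]; split.
- by move=> y _; exact: coord_continuous.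
- move=> _ [j _ <-]; exists (cst ((delta_mx 0 j : 'rV[R]_3) 0 i)); first exact: sc_cst.
  move=> y _; apply: (@is_derive_quadratic _ _ _ _ _ _ 1 0) => // k _.
  by rewrite !mxE addrK subrr normr0 mul0r.
- move=> y Uy; apply: laplace_moment_continuous.
  + exact: measurable_gamma_domain.
  + exact: measurable_gamma_base.
  + exact: measurable_gamma_log.
  + exact: gamma_base_ge0.
  + by apply: gamma_dominated; exact: hc.
- move=> _ [j _ <-].
  exists (laplace_moment gamma_domain (gamma_base h) (gamma_log c) (j :: s)).
    by apply: sc_gen; exact: pb_gamma.
  move=> y Uy; apply: laplace_moment_derive.
  + exact: measurable_gamma_domain.
  + exact: measurable_gamma_base.
  + exact: measurable_gamma_log.
  + exact: gamma_base_ge0.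
  + by apply: gamma_dominated; exact: hc.
- move=> y [h0 h1 h2]; apply: laplace_moment_continuous.
  + exact: measurable_euler_domain.
  + exact: measurable_euler_base.
  + exact: measurable_euler_log.
  + exact: euler_base_ge0.
  + exact: euler_dominated.
- move=> _ [j _ <-].
  exists (laplace_moment euler_domain (euler_base h) (euler_log x) (j :: s)).
    by apply: sc_gen; exact: pb_euler.
  move=> y [h0 h1 h2]; apply: laplace_moment_derive.
  + exact: measurable_euler_domain.
  + exact: measurable_euler_base.
  + exact: measurable_euler_log.
  + exact: euler_base_ge0.
  + exact: euler_dominated.
Qed.

Local Notation sc := (smooth_closure param_nbhd param_base).

Lemma sc_gamma (c0 c1 c2 : R) :
  (forall y, param_nbhd y -> h < y 0 0 * c0 + y 0 1 * c1 + y 0 2 * c2) ->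
  sc (fun y => Gamma (y 0 0 * c0 + y 0 1 * c1 + y 0 2 * c2 - h)).
Proof.
move=> hc; pose c (i : 'I_3) : R := [:: c0; c1; c2]`_i.
have gE y : gamma_form c y = y 0 0 * c0 + y 0 1 * c1 + y 0 2 * c2.
  by rewrite /gamma_form sum_ord3 /c/=.
rewrite (_ : (fun y => _) =
    laplace_moment gamma_domain (gamma_base h) (gamma_log c) [::]).
  by apply: sc_gen; apply: pb_gamma => y Uy; rewrite gE; exact: hc.
by apply/funext => y; rewrite gamma_momentE gE.
Qed.

Lemma sc_euler x : 0 <= x <= 1 -> sc (fun y =>
  euler_integral (y 0 2 - y 0 0) (y 0 1 - h) (y 0 1 - y 0 0) x).
Proof.
move=> x01; rewrite (_ : (fun y => _) =
    laplace_moment euler_domain (euler_base h) (euler_log x) [::]).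
  by apply: sc_gen; exact: pb_euler.
by apply/funext => y; rewrite euler_momentE.
Qed.

(** The normalizing Beta integral becomes an Euler integral at x = 0, so its dependence on the
    parameters is covered by [sc_euler]. *)
Lemma Beta_euler (p q A : R) : Beta p q = euler_integral p q A 0.
Proof.
apply: eq_Rintegral => t _.
by rewrite /euler_weight mul0r subr0 powR1 mulr1.
Qed.

Definition gauss_formula (x al be ga : R) : R :=
  Gamma (be - h) * Gamma (ga - h) / (Gamma (be - al + ga - h) * Gamma (al - h))
  * x `^ (be - al + ga - h - 1)
  * hyp2F1 (be - al) (ga - al) (be - al + ga - h) x.

Lemma gauss_formula_smooth x : 0 < x <= 1 -> exists2 F,
  smooth_open param_nbhd F &
  forall y, param_nbhd y -> F y = gauss_formula x (y 0 0) (y 0 1) (y 0 2).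
Proof.
move=> /andP[x0 x1]; have x01 : 0 <= x <= 1 by rewrite ltW.
have z01 : 0 <= (0 : R) <= 1 by rewrite lexx ler01.
pose G c0 c1 c2 (y : 'rV[R]_3) :=
  Gamma (y 0 0 * c0 + y 0 1 * c1 + y 0 2 * c2 - h).
pose H z (y : 'rV[R]_3) :=
  euler_integral (y 0 2 - y 0 0) (y 0 1 - h) (y 0 1 - y 0 0) z.
pose e (y : 'rV[R]_3) := y 0 1 + - 1 * y 0 0 + y 0 2 + (- h - 1).
(* Inverses become powers of exponent -1 and x^e becomes exp (e ln x), since the class is closed
   under these forms; the latter requires x > 0. *)
exists (fun y => G 0 1 0 y * G 0 0 1 y * (G (-1) 1 1 y * G 1 0 0 y) `^ (-1)
   * expR (e y * ln x) * (H x y * H 0 y `^ (-1))).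
  apply: (smooth_closure_open open_param_nbhd param_base_stable).
  have s1 : sc (G 0 1 0) by apply: sc_gamma => y [? ? ?]; lra.
  have s2 : sc (G 0 0 1) by apply: sc_gamma => y [? ? ?]; lra.
  have s3 : sc (G (-1) 1 1) by apply: sc_gamma => y [? ? ?]; lra.
  have s4 : sc (G 1 0 0) by apply: sc_gamma => y [? ? ?]; lra.
  have sH z : 0 <= z <= 1 -> sc (H z) by exact: sc_euler.
  have co i : sc (fun y => y 0 i) by apply: sc_gen; exact: pb_coord.
  apply: sc_mul; first apply: sc_mul.
  - apply: sc_mul; first exact: sc_mul.
    apply: sc_powR; last exact: sc_mul.
    by move=> y [? ? ?]; rewrite mulr_gt0//; apply: Gamma_gt0; lra.
  - apply: sc_expR; apply: sc_mul; last exact: (sc_cst _ _ (ln x)).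
    apply: sc_add; last exact: (sc_cst _ _ (- h - 1)).
    apply: sc_add => //; apply: sc_add => //; apply: sc_mul => //.
    exact: (sc_cst _ _ (- 1)).
  - apply: sc_mul; first exact: sH.
    apply: sc_powR; last exact: sH.
    by move=> y [? ? ?]; rewrite /H -Beta_euler; apply: Beta_gt0; lra.
move=> y [h0 h1 h2]; rewrite /gauss_formula.
have -> : G 0 1 0 y = Gamma (y 0 1 - h) by congr Gamma; ring.
have -> : G 0 0 1 y = Gamma (y 0 2 - h) by congr Gamma; ring.
have -> : G (-1) 1 1 y = Gamma (y 0 1 - y 0 0 + y 0 2 - h) by congr Gamma; ring.
have -> : G 1 0 0 y = Gamma (y 0 0 - h) by congr Gamma; ring.
(* The third parameter is split as p + q with p = gamma - alpha and q = beta - h, as in Euler's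
   integral. *)
have E : y 0 1 - y 0 0 + y 0 2 - h = (y 0 2 - y 0 0) + (y 0 1 - h) by ring.
have -> : hyp2F1 (y 0 1 - y 0 0) (y 0 2 - y 0 0) (y 0 1 - y 0 0 + y 0 2 - h) x
    = H x y * H 0 y `^ (-1).
  rewrite E hyp2F1_euler ?subr_gt0//; last 2 first.
  - exact: lt_trans h0 h1.
  - exact: euler_integrable.
  rewrite powR_inv1 /H -?Beta_euler// ltW// Beta_gt0 ?subr_gt0//.
  exact: lt_trans h0 h1.
rewrite powR_inv1; last by rewrite ltW// mulr_gt0// Gamma_gt0//; lra.
have Ee : e y = y 0 1 - y 0 0 + y 0 2 - h - 1 by rewrite /e; ring.
by rewrite (powR_expR_ln _ x0) Ee.
Qed.

End ParameterSpace.

(** * Dependence on the radius and on the scale *)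

(** As alpha > d/2 >= 1/2, the last condition gives (beta - alpha) + (gamma - alpha) >= alpha + 1/2
    > 1; with a positive product, both differences are positive. The exponent is at least 2 alpha -
    d/2 - 1/2 > d/2 - 1/2 >= 0. *)
Lemma paramP_bounds (R : realType) (d : nat) (al be ga : R) : (1 <= d)%N ->
  paramP d al be ga ->
  [/\ d%:R / 2 < al, al < be, al < ga & 0 < be - al + ga - d%:R / 2 - 1].
Proof.
move=> d1 [[a0 b0 g0] hd ab s].
have d1' : 1 <= d%:R :> R by rewrite ler1n.
have p0 : 0 < (be - al) * (ga - al).
  by move: ab; rewrite -mulrA; move: ((be - al) * (ga - al)) => z; lra.
have s0 : 1 < (be - al) + (ga - al) by lra.
have ba : 0 < be - al.
  rewrite ltNge; apply/negP => ba; have ga' : 0 < ga - al by lra.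
  by have := mulr_le0_ge0 ba (ltW ga'); lra.
have ga' : 0 < ga - al by rewrite -(pmulr_rgt0 _ ba).
by split; lra.
Qed.

Section RadialPart.
Context {R : realType} (d : nat) (al be ga : R).
Hypotheses (d1 : (1 <= d)%N) (P : paramP d al be ga).
Let h : R := d%:R / 2.
Let e : R := be - al + ga - h - 1.

Definition gauss_coef (n : nat) : R :=
  pochhammer (be - al) n * pochhammer (ga - al) n /
    (pochhammer (be - al + ga - h) n * n`!%:R).

Definition gauss_profile (K x : R) : R := K * x `^ e * limn (pseries gauss_coef x).

Let e0 : 0 < e.
Proof. by have [] := paramP_bounds d1 P. Qed.

Lemma gauss_coef_ge0 n : 0 <= gauss_coef n.
Proof.
have [h0 h1 h2 h3] := paramP_bounds d1 P.
by rewrite divr_ge0 ?mulr_ge0// ltW// pochhammer_gt0//; rewrite /h; lra.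
Qed.

(** Up to the Beta factor, the sum is Euler's integral at x = 1, which is finite. *)
Lemma gauss_coef_summable : cvgn (series gauss_coef).
Proof.
have [h0 h1 h2 h3] := paramP_bounds d1 P.
pose y : 'rV[R]_3 := \row_i [:: al; be; ga]`_i.
have y0 : y 0 0 = al by rewrite mxE.
have y1 : y 0 1 = be by rewrite mxE.
have y2 : y 0 2 = ga by rewrite mxE.
have o01 : 0 <= (1 : R) <= 1 by rewrite ler01 lexx.
have := @euler_integrable R h 1 o01 y; rewrite y0 y1 y2 => /(_ h0 h1 h2) ie.
have p0 : 0 < ga - al by rewrite subr_gt0.
have q0 : 0 < be - h by rewrite subr_gt0 (lt_trans h0).
have A0 : 0 < be - al by rewrite subr_gt0.
have := hyp2F1_cvg p0 q0 A0 o01 ie.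
have -> : ga - al + (be - h) = be - al + ga - h by ring.
under eq_fun do rewrite expr1n mulr1.
exact: cvgP.
Qed.

Lemma gauss_coef_radius : radius_ge1 gauss_coef.
Proof.
have [K [_ HK]] := cvg_series_bounded gauss_coef_summable.
by apply: (@radius_ge1_bounded _ _ (K + 1)) => n; apply: HK => //; rewrite ltrDl.
Qed.

Lemma gauss_profile0 K : gauss_profile K 0 = 0.
Proof. by rewrite /gauss_profile powR0 ?mulr0 ?mul0r// gt_eqF. Qed.

Lemma gauss_profile_continuous K (X : R -> R) : continuous X ->
  (forall r, 0 <= X r <= 1) -> continuous (fun r => gauss_profile K (X r)).
Proof.
move=> cX X01 r.
have c1 : {for r, continuous (fun s => X s `^ e)}.
  by apply: (powR_continuous_comp e0 cX) => s; case/andP: (X01 s).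
have c2 : {for r, continuous (fun s => limn (pseries gauss_coef (X s)))}.
  apply: pseries_continuous_closed => //; first exact: gauss_coef_ge0.
  exact: gauss_coef_summable.
have c3 : {for r, continuous (fun s => K * X s `^ e)}.
  by apply: continuousM => //; exact: cst_continuous.
exact: continuousM c3 c2.
Qed.

Lemma gauss_profile_smooth K I (X : R -> R) : open [set` I] ->
  (forall x, x \in I -> 0 < X x < 1) -> smooth_closure [set` I] [set id] X ->
  smooth_itv I (fun r => gauss_profile K (X r)).
Proof.
move=> oI X01 sX; apply: (smooth_closure_itv oI (@derivation_stable_id _ _)).
apply: sc_mul; first apply: sc_mul.
- exact: sc_cst.
- by apply: sc_powR => // x xI; case/andP: (X01 x xI).
- apply: sc_pseries => //; first exact: gauss_coef_radius.
  by move=> x xI; case/andP: (X01 x xI) => x0 x1; rewrite gtr0_norm.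
Qed.

End RadialPart.

(** * Regularity of the covariance in the radius, the scale and the parameters *)

Theorem theorem5 (R : realType) (d : nat) (hd : (1 <= d)%N) :
  (* with respect to r *)
  (forall a alpha beta gamma : R, 0 < a -> paramP d alpha beta gamma ->
     [/\ {within `[0, +oo[%classic,
            continuous (fun r : R => gauss_cov d r a alpha beta gamma)},
         smooth_itv `]0, a[ (fun r : R => gauss_cov d r a alpha beta gamma) &
         smooth_itv `]a, +oo[
           (fun r : R => gauss_cov d r a alpha beta gamma)])
  /\
  (* with respect to a *)
  (forall r alpha beta gamma : R, 0 <= r -> paramP d alpha beta gamma ->
     [/\ {within `]0, r[%classic,
            continuous (fun a : R => gauss_cov d r a alpha beta gamma)},
         smooth_itv `]0, r[ (fun a : R => gauss_cov d r a alpha beta gamma),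
         {within `]r, +oo[%classic,
            continuous (fun a : R => gauss_cov d r a alpha beta gamma)} &
         smooth_itv `]r, +oo[
           (fun a : R => gauss_cov d r a alpha beta gamma)])
  /\
  (* with respect to (alpha, beta, gamma) *)
  (forall r a : R, 0 <= r -> 0 < a ->
     {within @paramP_set R d, continuous (fun t : 'rV[R]_3 =>
        gauss_cov d r a (t 0 0) (t 0 1) (t 0 2))} /\
     smooth_on (@paramP_set R d) (fun t : 'rV[R]_3 =>
        gauss_cov d r a (t 0 0) (t 0 1) (t 0 2))).
Proof.
have ooo (a b : R) : open [set` `]a, b[] by exact: interval_open.
have ooy (a : R) : open [set` `]a, +oo[] by exact: interval_open.
pose X (r a : R) := Num.max (1 - r ^+ 2 / a ^+ 2) 0.
pose K (al be ga : R) := Gamma (be - d%:R / 2) * Gamma (ga - d%:R / 2)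
    / (Gamma (be - al + ga - d%:R / 2) * Gamma (al - d%:R / 2)).
have E r a al be ga : gauss_cov d r a al be ga =
  gauss_profile d al be ga (K al be ga) (X r a) by [].
have Xpos (r a : R) : 0 <= r < a -> X r a = 1 - r ^+ 2 / a ^+ 2.
  move=> /andP[r0 ra]; have a0 : 0 < a by exact: le_lt_trans ra.
  apply/max_idPl; rewrite subr_ge0 ler_pdivrMr ?exprn_gt0// mul1r.
  by rewrite ler_sqr ?nnegrE// ltW.
have Xpos1 (r a : R) : 0 < r < a -> 0 < 1 - r ^+ 2 / a ^+ 2 < 1.
  move=> /andP[r0 ra]; have a0 : 0 < a by exact: lt_trans ra.
  rewrite subr_gt0 gtrBl ltr_pdivrMr ?exprn_gt0// mul1r divr_gt0 ?exprn_gt0// andbT.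
  by rewrite ltr_sqr ?nnegrE// ltW.
have Xneg (r a : R) : 0 < a <= r -> X r a = 0.
  move=> /andP[a0 ar]; have r0 : 0 < r by exact: lt_le_trans ar.
  apply/max_idPr; rewrite subr_le0 ler_pdivlMr ?exprn_gt0// mul1r.
  by rewrite ler_sqr ?nnegrE// ltW.
have X01 (r a : R) : 0 <= X r a <= 1.
  rewrite le_max lexx orbT/= ge_max ler01 andbT gerBl.
  by rewrite divr_ge0// sqr_ge0.
split; last split.
- move=> a al be ga a0 P; split.
  + apply: continuous_subspaceT.
    rewrite (_ : (fun r => _) =
      fun r => gauss_profile d al be ga (K al be ga) (X r a))//.
    apply: gauss_profile_continuous => // r.
    have cu : {for r, continuous (fun s : R => 1 - s ^+ 2 / a ^+ 2)}.
      apply: continuousB; first exact: cst_continuous.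
      by apply: continuousM; [exact: exprn_continuous|exact: cst_continuous].
    exact: (continuous_max cu (@cst_continuous _ _ 0 r)).
  + apply: (@smooth_itv_ext _ _ (fun r => gauss_profile d al be ga (K al be ga)
      (1 - r ^+ 2 / a ^+ 2))) => //.
      move=> r; rewrite in_itv/= => /andP[r0 ra].
      by rewrite E Xpos// ltW.
    apply: gauss_profile_smooth => //.
      by move=> r; rewrite in_itv/=; exact: Xpos1.
    rewrite (_ : (fun r : R => 1 - r ^+ 2 / a ^+ 2) =
        fun r : R => 1 + (- a ^- 2) * (r * r)).
      apply: sc_add; first exact: (sc_cst _ _ 1).
      apply: sc_mul; first exact: (sc_cst _ _ (- a ^- 2)).
      by apply: sc_mul; apply: sc_gen.
    by apply/funext => r /=; rewrite mulNr mulrC -expr2.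
  + apply: (@smooth_itv_ext _ _ (cst 0)) => //; last exact: smooth_itv_cst.
    move=> r; rewrite in_itv/= andbT => ar.
    by rewrite E Xneg ?gauss_profile0// a0 ltW.
- move=> r al be ga r0 P.
  have s1 : smooth_itv `]0, r[ (fun a : R => gauss_cov d r a al be ga).
    apply: (@smooth_itv_ext _ _ (cst 0)) => //; last exact: smooth_itv_cst.
    move=> a; rewrite in_itv/= => /andP[a0 ar].
    by rewrite E Xneg ?gauss_profile0// a0 ltW.
  have s2 : smooth_itv `]r, +oo[ (fun a : R => gauss_cov d r a al be ga).
    (* For r = 0 one has x = 1 for every a, outside the open disk where the power series is
       differentiated; the function of a is then constant. *)
    have [rE|r1] := eqVneq r 0.
      apply: (@smooth_itv_ext _ _ (cst (gauss_profile d al be ga (K al be ga) 1)));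
        [by []| |exact: smooth_itv_cst].
      move=> a; rewrite in_itv/= andbT => ra.
      by rewrite E Xpos ?r0// rE expr0n/= mul0r subr0.
    have {}r0 : 0 < r by rewrite lt_neqAle eq_sym r1.
    apply: (@smooth_itv_ext _ _ (fun a => gauss_profile d al be ga (K al be ga)
      (1 + - r ^+ 2 * (a * a) `^ (-1)))) => //.
      move=> a; rewrite in_itv/= andbT => ra.
      rewrite E Xpos ?(ltW r0)// powR_inv1 ?mulNr//.
      by rewrite mulr_ge0// ltW// (lt_trans r0).
    apply: gauss_profile_smooth => //.
      move=> a; rewrite in_itv/= andbT => ra.
      rewrite powR_inv1 ?mulNr; last by rewrite mulr_ge0// ltW// (lt_trans r0).
      by apply: Xpos1; rewrite r0.
    apply: sc_add; first exact: (sc_cst _ _ 1).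
    apply: sc_mul; first exact: (sc_cst _ _ (- r ^+ 2)).
    apply: sc_powR; last by apply: sc_mul; apply: sc_gen.
    move=> a; rewrite /= in_itv/= andbT => ra.
    by rewrite mulr_gt0// (lt_trans r0).
  by split=> //; exact: smooth_itv_continuous.
- move=> r a r0 a0.
  have PU (t : 'rV[R]_3) : paramP_set d t -> param_nbhd (d%:R / 2) t.
    by move=> /(paramP_bounds hd)[? ? ? ?].
  have [F sF FE] : exists2 F, smooth_open (param_nbhd (d%:R / 2)) F &
      forall t, paramP_set d t ->
        F t = gauss_cov d r a (t 0 0) (t 0 1) (t 0 2).
    have [x0|x0] := eqVneq (X r a) 0.
      exists (cst 0).
        apply: (smooth_closure_open (@open_param_nbhd _ _)
          (@param_base_stable R (d%:R / 2))).
        exact: sc_cst.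
      by move=> t Pt; rewrite E x0 gauss_profile0.
    have [|F sF FE] := @gauss_formula_smooth R (d%:R / 2) (X r a).
      by case/andP: (X01 r a) => x1 ->; rewrite lt_neqAle eq_sym x0 x1.
    by exists F => // t /PU /FE.
  split.
    apply: (@subspace_eq_continuous _ _ _ F).
      by move=> t; rewrite inE => /FE.
    apply: continuous_in_subspaceT => t; rewrite inE => /PU Ut.
    by have [cF _] := sF [::] t Ut.
  exists (param_nbhd (d%:R / 2)), F; split=> //.
  exact: open_param_nbhd.
Qed.
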